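(* Every recognizable linear suffix term rewriting system $R$ has a rational derivation, i.e. the relation $\to_R^*\subseteq T(F)\times T(F)$, viewed as a language of pairs of terms, belongs to $\mathrm{Rat}_2$.
   Context: Let $F$ be a finite ranked alphabet and $X$ a finite set of variables; $T(F,X)$ denotes terms, $T(F)$ ground terms; a term word is a tuple of terms. A $1$-context is a linear term with exactly one variable $\square$, $c[s]$ being $c$ with $\square$ replaced by $s$. A rewrite rule is a pair $(l,r)$ with $\mathrm{Var}(r)\subseteq\mathrm{Var}(l)$; a system is a set of rules, linear if both sides of each rule are linear. A system is recognizable if it is given as a finite union of sets $U\times V$ of rules with $U,V$ recognizable term languages (recognized by finite tree automata, variables treated as constants), using only finitely many distinct variables. $\to_R=\{(c[l\sigma],c[r\sigma])\in T(F)^2\mid(l,r)\in R,\ c\text{ a 1-context},\ \sigma\text{ a substitution}\}$, and $\to_R^*$ is its reflexive–transitive closure. $R$ is suffix if any overlapping between a right-hand side $r$ and a left-hand side $l$ of $R$ is such that $l=\bar l[r]$ or $r=\bar r[l]$ for some (possibly trivial) $1$-contexts $\bar l,\bar r$. Rational languages: for a term word $t$ whose variables come as numbered instances, a word $x=x(1)\dots x(n)$ of variables with $k\ge0$ instances $x_1,\dots,x_k$ in $t$, and a set $M$ of $n$-tuples, $t\cdot_xM$ is the set of term words obtained by choosing $s_1,\dots,s_k\in M$ independently and replacing each $x_i(j)$ by $s_i(j)$; $L\cdot_xM=\bigcup_{t\in L}t\cdot_xM$, $L^{0_x}=\{x\}$, $L^{n_x}=L\cdot_xL^{(n-1)_x}$,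 $L^{*_x}=\bigcup_{n\ge0}L^{n_x}$. $\mathrm{Rat}_n$ is the smallest family of languages of $n$-tuples of terms containing finite languages and closed under union, under $L\cdot_xM$ ($L\in\mathrm{Rat}_n$, $x\in X^m$, $M\in\mathrm{Rat}_m$) and under $L^{*_x}$ ($L\in\mathrm{Rat}_n$, $x\in X^n$). *)

(* Defs.v *)
From mathcomp Require Import all_boot.
From mathcomp Require Import classical_sets cardinality.
From Stdlib Require Import Relation_Operators.

Set Implicit Arguments.
Unset Strict Implicit.
Unset Printing Implicit Defensive.

Local Open Scope classical_set_scope.

(** The symbols of the ranked alphabet are the elements of a finite type [F],
    and [ar] is the arity.  [term ar V] is T(F,V); ground terms are the terms
    over the empty type of variables, i.e. T(F) is [term ar void]. *)
Inductive term (F : finType) (ar : F -> nat) (V : Type) : Type :=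
| Var of V
| App (f : F) of {ffun 'I_(ar f) -> term ar V}.

Arguments Var {F ar V}.
Arguments App {F ar V}.

Section Terms.
Variables (F : finType) (ar : F -> nat).
Local Notation T := (term ar).

Fixpoint subst (V W : Type) (s : V -> T W) (t : T V) : T W :=
  match t with
  | Var v => s v
  | App f a => App f [ffun i => subst s (a i)]
  end.

Definition rename (V W : Type) (h : V -> W) : T V -> T W :=
  subst (fun v => Var (h v)).

Definition of_ground (V : Type) : T void -> T V := rename (of_void V).

Fixpoint occ (V : eqType) (v : V) (t : T V) : nat :=
  match t with
  | Var w => v == w
  | App f a => \sum_i occ v (a i)
  end.

Definition in_vars (V : eqType) (v : V) (t : T V) : bool := 0 < occ v t.

Definition linear (V : eqType) (t : T V) : Prop := forall v, occ v t <= 1.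

Definition is_var (V : Type) (t : T V) : bool :=
  if t is Var _ then true else false.

(** In a term over [option V], the variable [None] plays the role of the box.
    When it occurs exactly once, such a term points at a position of the term
    [fill C s], the part of the term outside this position being allowed to
    contain variables of [V].  A 1-context contains no variable besides the
    box, hence lives over [option void]. *)
Definition one_hole (V : eqType) (C : T (option V)) : Prop := occ None C = 1.

Definition fill (V : Type) (C : T (option V)) (s : T V) : T V :=
  subst (fun o => if o is Some v then Var v else s) C.

Definition context1 : Type := {c : T (option void) | occ None c == 1}.

Definition ctx_in (V : Type) (c : context1) : T (option V) :=
  rename (omap (of_void V)) (val c).

(** Tree automata: nondeterministic, bottom-up, variables being read as
    constants. *)
Record automaton (V : Type) := Automaton {
  state : finType;
  final : {set state};
  var_trans : V -> {set state};
  app_trans : forall f : F, {ffun 'I_(ar f) -> state} -> {set state}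
}.

Fixpoint reach (V : Type) (A : automaton V) (t : T V) : {set state A} :=
  match t with
  | Var v => var_trans A v
  | App f a =>
      [set q | [exists qs : {ffun 'I_(ar f) -> state A},
         [forall i, qs i \in reach A (a i)] && (q \in app_trans qs)]]
  end.

Definition accepts (V : Type) (A : automaton V) (t : T V) : bool :=
  [exists q in final A, q \in reach A t].

Definition recognizable (V : Type) (L : set (T V)) : Prop :=
  exists A : automaton V, L = [set t | accepts A t].

Section Systems.
Variable X : finType.
Implicit Types (R : set (T X * T X)) (l r s t u : T X).

Definition is_trs R : Prop :=
  forall l r, R (l, r) -> forall x, in_vars x r -> in_vars x l.

Definition linear_trs R : Prop :=
  forall l r, R (l, r) -> linear l /\ linear r.

Definition recognizable_trs R : Prop :=
  exists (k : nat) (U V : 'I_k -> set (T X)),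
    (forall i, recognizable (U i) /\ recognizable (V i)) /\
    R = \bigcup_i (U i `*` V i).

Definition rewrite_step R (s t : T void) : Prop :=
  exists l r (c : context1) (sigma : X -> T void),
    [/\ R (l, r),
        s = fill (val c) (subst sigma l) &
        t = fill (val c) (subst sigma r)].

Definition derivation R : T void -> T void -> Prop :=
  clos_refl_trans (T void) (rewrite_step R).

(** [overlap t u C]: [u] overlaps [t] when placed at the position [C] of [t].
    The subterm of [t] at this position and [u], whose variables are considered
    disjoint (hence the two substitutions), are unifiable, and neither of [t]
    and [u] is placed at (or below) a variable of the other one: this excludes a
    variable subterm of [t], and also a variable [u] placed at the root of
    [t].  A variable [u] does overlap [t] at a position strictly below the root
    whose subterm is not a variable. *)
Definition overlap t u (C : T (option X)) : Prop :=
  exists s,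
    [/\ one_hole C,
        t = fill C s,
        ~~ is_var s,
        ~ (C = Var None /\ is_var u) &
        exists sigma tau : X -> T X, subst sigma s = subst tau u].

(** [t = c[u]] for a 1-context [c] pointing at the position [C], up to the names
    of the variables of [u]. *)
Definition nested t u (C : T (option X)) : Prop :=
  exists (c : context1) (rho : X -> X),
    [/\ injective rho, C = ctx_in X c & t = fill (ctx_in X c) (rename rho u)].

(** An overlap is either at a position of the left-hand side [l], and then one
    requires [l = c[r]] for the 1-context [c] at this position, or at a position
    of the right-hand side [r], and then one requires [r = c[l]]. *)
Definition suffix_trs R : Prop :=
  forall l0 r l r0, R (l0, r) -> R (l, r0) ->
  forall C, (overlap l r C -> nested l r C) /\ (overlap r l C -> nested r l C).

End Systems.

Section Rational.
Variable Y : finType.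

(** The variable [(y, i)] is the [i]-th instance of [y].  In a term word,
    [(y, i)] and [(z, i)] belong to the same instance of the word [yz]. *)
Definition ivar : Type := (Y * nat)%type.

Definition tword (n : nat) : Type := n.-tuple (T ivar).

Definition occw n (v : ivar) (t : tword n) : nat :=
  \sum_(j < n) occ v (tnth t j).

(** Distinct occurrences of a variable are distinct numbered instances. *)
Definition numbered n (t : tword n) : Prop := forall v, occw v t <= 1.

Definition has_instance n m (x : m.-tuple Y) (t : tword n) (i : nat) : Prop :=
  exists2 y, y \in x & 0 < occw (y, i) t.

(** Replaces [(x(j), i)] by the [j]-th component of [s i], in which the number
    [k] of each instance is changed into [nu i k]. *)
Definition inst_subst m (x : m.-tuple Y) (s : nat -> tword m)
    (nu : nat -> nat -> nat) (v : ivar) : T ivar :=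
  if insub (index v.1 x) is Some j
  then rename (fun w : ivar => (w.1, nu v.2 w.2)) (tnth (s v.2) j)
  else Var v.

(** [t ._x M].  The renumbering [nu] keeps the instances coming from the
    different [s i] apart from each other and from those that remain in [t]. *)
Definition wprod1 n m (t : tword n) (x : m.-tuple Y) (M : set (tword m)) :
    set (tword n) :=
  [set t' | exists (s : nat -> tword m) (nu : nat -> nat -> nat),
     [/\ forall i, has_instance x t i -> M (s i),
         forall i k i' k', nu i k = nu i' k' -> i = i' /\ k = k',
         forall y k, y \notin x -> 0 < occw (y, k) t -> forall i j, nu i j <> k &
         t' = [tuple subst (inst_subst x s nu) (tnth t j) | j < n]]].

Definition wprod n m (L : set (tword n)) (x : m.-tuple Y) (M : set (tword m)) :
    set (tword n) :=
  \bigcup_(t in L) wprod1 t x M.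

Definition word_of n (x : n.-tuple Y) : tword n :=
  [tuple Var (tnth x j, 0) | j < n].

Fixpoint wpow n (L : set (tword n)) (x : n.-tuple Y) (k : nat) :
    set (tword n) :=
  if k is k'.+1 then wprod L x (wpow L x k') else [set word_of x].

Definition wstar n (L : set (tword n)) (x : n.-tuple Y) : set (tword n) :=
  \bigcup_k wpow L x k.

(** The words of variables along which one substitutes consist of distinct
    variables, so that [x(j)] determines [j]. *)
Inductive Rat : forall n, set (tword n) -> Prop :=
| Rat_finite n (L : set (tword n)) :
    finite_set L -> (forall t, L t -> numbered t) -> Rat L
| Rat_union n (L M : set (tword n)) :
    Rat L -> Rat M -> Rat (L `|` M)
| Rat_prod n m (L : set (tword n)) (x : m.-tuple Y) (M : set (tword m)) :
    uniq x -> Rat L -> Rat M -> Rat (wprod L x M)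
| Rat_star n (L : set (tword n)) (x : n.-tuple Y) :
    uniq x -> Rat L -> Rat (wstar L x).

Definition pair_lang (E : T void -> T void -> Prop) : set (tword 2) :=
  [set w | exists s t, E s t /\ w = [tuple of_ground ivar s; of_ground ivar t]].

End Rational.

End Terms.

Arguments pair_lang {F ar} Y E.

(* Main.v *)
Require Import Defs.
From mathcomp Require Import all_boot.
From mathcomp Require Import boolp classical_sets cardinality.
From mathcomp Require Import zify.
From Stdlib Require Import Relation_Operators Operators_Properties Eqdep_dec.

(** If a right-hand side overlaps a left-hand side, one of them is the other one
    inside a ground context; so inside a chain of overlapping steps the variables
    stay at the same places and act as constants, and the chain is a derivation
    of a ground recognizable system.  Reading variables as constants, the terms
    [u] that derive a left-hand side [l], and the terms [v] derived from a
    right-hand side [r], then form regular languages.  Reordering steps shows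
    that the derivation relation is the least relation closed under contexts and
    under [(s x, s' x)_x |-> (u s, v s')] for such pairs [(u, v)]: this is proved
    by extending a pair by one step on the right, where the step is either merged
    into [v], pushed below a variable of [v], or takes place at the root of a
    pair of terms with the same root symbol, in which case the left-hand side is
    pulled back along the components.  This closure is generated by a finite
    grammar on tuples of terms, and a grammar is turned into a rational
    expression by eliminating its nonterminals one at a time. *)

Set Implicit Arguments.
Unset Strict Implicit.
Unset Printing Implicit Defensive.

(** * Terms *)

Section Terms.
Variables (F : finType) (ar : F -> nat).
Local Notation T := (term ar).

(** The suffix condition constrains right-hand sides only, whereas a chain soon leaves them: after
    one merged step [v] need not be a right-hand side any more. [good] is the invariant that
    survives such steps, and its stability is the core of the rewriting half. Erasure is the second
    obstacle. A variable of a left-hand side may be missing on the right, so [u] can have variables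
    that [v] lacks. A junk constant replaces them; then both sides have the same variables, each
    occurring at most once. The third obstacle is that [u] and [v] must be generated together, since
    each variable has to receive the two components of one and the same pair, while both terms are
    unbounded. Linearity keeps this finite: the unfinished subterms of one side that still contain
    variables have disjoint nonempty variable sets, so at most [#|X|] of them are pending at a time,
    and each is named by its set. One nonterminal carries them all; subterms without variables split
    off into nonterminals of their own. *)

Lemma term_rec_ffun (V : Type) (P : T V -> Prop) :
  (forall v, P (Var v)) -> (forall f (a : {ffun 'I_(ar f) -> T V}), (forall i, P (a i)) -> P (App f a)) ->
  forall t, P t.
Proof.
move=> PV PA; fix IH 1 => -[v|f a]; first exact: PV.
by apply: PA => i; apply: IH.
Qed.

Lemma App_inj V f (a b : {ffun 'I_(ar f) -> T V}) : App f a = App f b -> a = b.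
Proof.
case=> e; apply: (inj_pair2_eq_dec F _ (fun f => {ffun 'I_(ar f) -> T V})) => //.
by move=> x y; case: (x =P y); [left|right].
Qed.

Lemma subst_ext V W (s s' : V -> T W) : s =1 s' -> subst s =1 subst s'.
Proof.
move=> ss'; elim/term_rec_ffun => [v|f a IH] //=.
by congr App; apply/ffunP => i; rewrite !ffunE IH.
Qed.

Lemma subst_var V (t : T V) : subst Var t = t.
Proof.
elim/term_rec_ffun: t => [v|f a IH] //=.
by congr App; apply/ffunP => i; rewrite !ffunE IH.
Qed.

Lemma subst_comp V W U (s : V -> T W) (s' : W -> T U) t :
  subst s' (subst s t) = subst (fun v => subst s' (s v)) t.
Proof.
elim/term_rec_ffun: t => [v|f a IH] //=.
by congr App; apply/ffunP => i; rewrite !ffunE IH.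
Qed.

Lemma subst_rename V W U (h : V -> W) (s : W -> T U) t :
  subst s (rename h t) = subst (fun v => s (h v)) t.
Proof. by rewrite /rename subst_comp. Qed.

Lemma rename_comp V W U (h : V -> W) (k : W -> U) (t : T V) :
  rename k (rename h t) = rename (fun v => k (h v)) t.
Proof. by rewrite {1}/rename subst_rename. Qed.

Lemma subst_of_ground V W (s : V -> T W) (t : T void) :
  subst s (of_ground V t) = of_ground W t.
Proof. by rewrite /of_ground subst_rename; apply: subst_ext => -[]. Qed.

Lemma ground_id (s : void -> T void) (t : T void) : subst s t = t.
Proof. by rewrite -[RHS]subst_var; apply: subst_ext => -[]. Qed.

Lemma subst_to_ground V (s : V -> T void) (t : T void) : subst s (of_ground V t) = t.
Proof. by rewrite subst_of_ground; apply: ground_id. Qed.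

Lemma occ_App (V : eqType) (v : V) f (a : {ffun 'I_(ar f) -> T V}) :
  occ v (App f a) = \sum_i occ v (a i).
Proof. by []. Qed.

Lemma occ_App_gt0 (V : eqType) (v : V) f (a : {ffun 'I_(ar f) -> T V}) :
  (0 < occ v (App f a)) = [exists i, 0 < occ v (a i)].
Proof.
rewrite occ_App lt0n sum_nat_eq0 negb_forall; apply: eq_existsb => i.
by rewrite lt0n.
Qed.

Lemma occ_arg_gt0 (V : eqType) (v : V) f (a : {ffun 'I_(ar f) -> T V}) i :
  0 < occ v (a i) -> 0 < occ v (App f a).
Proof. by move=> h; rewrite occ_App_gt0; apply/existsP; exists i. Qed.

Lemma eq_in_subst (V : eqType) W (s s' : V -> T W) (t : T V) :
  (forall v, 0 < occ v t -> s v = s' v) -> subst s t = subst s' t.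
Proof.
elim/term_rec_ffun: t => [v|f a IH] /= h; first by apply: h; rewrite eqxx.
congr App; apply/ffunP => i; rewrite !ffunE; apply: IH => v hv.
exact: h (occ_arg_gt0 hv).
Qed.

Lemma subst_inj_in (V : eqType) W (s s' : V -> T W) (t : T V) :
  subst s t = subst s' t -> forall v, 0 < occ v t -> s v = s' v.
Proof.
elim/term_rec_ffun: t => [w|f a IH] /= e v.
  by case: eqP => // ->.
rewrite occ_App_gt0 => /existsP[i]; apply: IH.
by move/App_inj/ffunP/(_ i): e; rewrite !ffunE.
Qed.

Lemma subst_closed (V : eqType) (s : V -> T V) t :
  (forall v, occ v t = 0) -> subst s t = t.
Proof. by move=> h; rewrite -[RHS]subst_var; apply: eq_in_subst => v; rewrite h. Qed.

Lemma occ_subst (V W : eqType) (s : V -> T W) (t : T V) w :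
  (0 < occ w (subst s t)) <-> exists2 v, 0 < occ v t & 0 < occ w (s v).
Proof.
elim/term_rec_ffun: t => [v|f a IH] /=.
  split=> [h|[v' ]]; first by exists v => //; rewrite eqxx.
  by case: eqP => // ->.
split.
  rewrite occ_App_gt0 => /existsP[i]; rewrite ffunE => /IH[v h1 h2].
  by exists v => //; exact: occ_arg_gt0 h1.
move=> [v]; rewrite occ_App_gt0 => /existsP[i h1] h2.
by rewrite occ_App_gt0; apply/existsP; exists i; rewrite ffunE; apply/IH; exists v.
Qed.

Lemma occ_rename_inj (V W : eqType) (h : V -> W) (t : T V) v :
  injective h -> occ (h v) (rename h t) = occ v t.
Proof.
move=> hI; elim/term_rec_ffun: t => [w|f a IH] /=; first by rewrite (inj_eq hI).
by apply: eq_bigr => i _; rewrite ffunE; exact: IH.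
Qed.

Lemma sum_bool_le1 (I : finType) (P : pred I) :
  (forall i j, P i -> P j -> i = j) -> \sum_i (P i : nat) <= 1.
Proof.
move=> h; case: (pickP P) => [i Pi|P0]; last by rewrite big1 // => i _; rewrite P0.
rewrite (bigD1 i) //= Pi big1 // => j ji.
by case Pj: (P j) => //; rewrite (h _ _ Pi Pj) eqxx in ji.
Qed.

End Terms.

(** * Grammars of tuples of terms *)

Section Kleene.
Variables (F : finType) (ar : F -> nat) (I : finType) (m : nat).
Local Notation T := (term ar).
Local Notation Y := (I * 'I_m)%type.
Local Notation V := (ivar Y).
Local Notation gtup n := (n.-tuple (T void)).
Local Notation tw n := (tword ar Y n).
Local Open Scope classical_set_scope.

Definition assign (a : I -> nat -> gtup m) (v : V) : T void :=
  tnth (a v.1.1 v.2) v.1.2.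

Definition has_inst n (i : I) (k : nat) (t : tw n) : Prop :=
  exists j, 0 < occw ((i, j), k) t.

Definition evaluate n (a : I -> nat -> gtup m) (t : tw n) : gtup n :=
  [tuple subst (assign a) (tnth t j) | j < n].

(** Nonterminals are read as the languages [rho]. Different instances of a nonterminal are chosen
    independently through [a], while the components of one instance come from the same tuple. *)
Definition sem n (L : set (tw n)) (rho : I -> set (gtup m)) : set (gtup n) :=
  [set w | exists t a, [/\ L t, forall i k, has_inst i k t -> rho i (a i k) & w = evaluate a t]].

Definition update (rho : I -> set (gtup m)) B S i := if i == B then S else rho i.

Definition nt_word (B : I) : m.-tuple Y := [tuple (B, j) | j < m].

Lemma occw_gt0 n (v : V) (t : tw n) :
  (0 < occw v t) <-> exists j, 0 < occ v (tnth t j).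
Proof.
rewrite /occw lt0n sum_nat_eq0 negb_forall; split.
  by move=> /existsP[j]; rewrite -lt0n; exists j.
by move=> [j h]; apply/existsP; exists j; rewrite -lt0n.
Qed.

Lemma index_nt_word B v : index v (nt_word B) = if v.1 == B then val v.2 else m.
Proof.
have mapE : nt_word B = [seq (B, j) | j <- enum 'I_m] :> seq _.
  by rewrite /nt_word /= -[RHS]/(val [tuple _ | _ < _]) /= map_comp.
case: v => i j /=; case: eqP => [->|ne].
  by rewrite mapE index_map ?index_enum_ord // => x y [].
rewrite memNindex ?size_tuple ?card_ord //; apply/negP => /mapP[k _ [e _]].
exact: ne.
Qed.

Lemma mem_nt_word B (v : Y) : (v \in nt_word B) = (v.1 == B).
Proof.
rewrite -index_mem index_nt_word size_tuple; case: ifP => _; first by rewrite ltn_ord.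
by rewrite ltnn.
Qed.

Lemma uniq_nt_word B : uniq (nt_word B).
Proof.
have -> : nt_word B = [seq (B, j) | j <- enum 'I_m] :> seq _.
  by rewrite /nt_word /= -[RHS]/(val [tuple _ | _ < _]) /= map_comp.
by rewrite map_inj_uniq ?enum_uniq // => x y [].
Qed.

Lemma inst_substE B (s : nat -> tw m) nu (v : V) :
  inst_subst (nt_word B) s nu v =
  if v.1.1 == B then rename (fun w : V => (w.1, nu v.2 w.2)) (tnth (s v.2) v.1.2)
  else Var v.
Proof.
rewrite /inst_subst index_nt_word; case: ifP => _.
  by rewrite valK.
by rewrite insubN // ltnn.
Qed.

Lemma has_instanceE n B (t : tw n) k : has_instance (nt_word B) t k <-> has_inst B k t.
Proof.
split=> [[y]|[j h]]; last by exists (B, j) => //; rewrite mem_nt_word /= eqxx.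
by rewrite mem_nt_word; case: y => i j /= /eqP-> h; exists j.
Qed.

(** Instance numbers from [N] on are fresh for [t], which leaves room for renumbering. *)
Lemma number_bound n (t : tw n) : exists N, forall v, 0 < occw v t -> v.2 < N.
Proof.
have bnd (s : T V) : exists N, forall v, 0 < occ v s -> v.2 < N.
  elim/term_rec_ffun: s => [w|f a IH].
    by exists w.2.+1 => v /=; case: eqP => // ->.
  have [N hN] := choice IH; exists (\max_i N i) => v.
  rewrite occ_App_gt0 => /existsP[i h].
  by apply: leq_trans (hN _ _ h) _; exact: leq_bigmax.
have [N hN] := choice (fun j => bnd (tnth t j)); exists (\max_j N j) => v.
move=> /occw_gt0[j h].
by apply: leq_trans (hN _ _ h) _; exact: leq_bigmax.
Qed.

Lemma sem_mono n (L L' : set (tw n)) rho rho' :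
  L `<=` L' -> (forall i, rho i `<=` rho' i) -> sem L rho `<=` sem L' rho'.
Proof.
move=> LL' rr' w [t [a [Lt h ->]]]; exists t, a; split=> //; first exact: LL'.
by move=> i k /h; apply: rr'.
Qed.

(** An instance of [B] has no word to be replaced by, so only the words without [B] survive, and
    they are left unchanged. The product with the empty language thus acts as a filter. *)
Lemma wprod_set0 n (L : set (tw n)) B :
  wprod L (nt_word B) set0 = [set t | L t /\ forall k, ~ has_inst B k t].
Proof.
have E (t : tw n) s nu : (forall k, ~ has_inst B k t) ->
    [tuple subst (inst_subst (nt_word B) s nu) (tnth t j) | j < n] = t.
  move=> hB; apply: eq_from_tnth => j; rewrite tnth_mktuple -[RHS]subst_var.
  apply: eq_in_subst => -[[i j'] k] hv; rewrite inst_substE /=.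
  case: eqP => // iB; case: (hB k); exists j'; apply/occw_gt0; exists j.
  by rewrite -iB.
apply/seteqP; split=> t.
  move=> [t0 Lt0 [s [nu [h _ _ ->]]]].
  have hB k : ~ has_inst B k t0 by move=> /has_instanceE/h.
  by rewrite E.
move=> [Lt hB]; exists t => //.
(* [wprod1] asks for a renumbering even when nothing is substituted; an injective pairing shifted by
   [N] avoids the instances of [t]. *)
have [N hN] := number_bound t.
exists (fun=> word_of ar (nt_word B)), (fun i k => N + pickle (i, k)); split.
- by move=> k /has_instanceE/hB.
- by move=> i k i' k' /addnI /(pcan_inj pickleK) [-> ->].
- by move=> y k _ /hN /= kN i j e; rewrite -e ltnNge leq_addr in kN.
- by rewrite E.
Qed.

(** A word may drop components of an instance, and then the rest of that
    instance no longer constrains it.  So each nonterminal has a nonempty set of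
    relevant components, which are the ones that carry its meaning, and an
    instance may not use only some of them. *)
Variable relevant : I -> pred 'I_m.
Hypothesis relevant_ex : forall i, exists j, relevant i j.

Definition complete n (t : tw n) : Prop :=
  forall i k j, has_inst i k t -> relevant i j -> 0 < occw ((i, j), k) t.

Definition clean n (t : tw n) : Prop :=
  forall v : V, 0 < occw v t -> relevant v.1.1 v.1.2.

Definition typed B (t : tw m) : Prop :=
  forall j (v : V), 0 < occ v (tnth t j) -> relevant v.1.1 v.1.2 = relevant B j.

Lemma occ_inst_subst B s nu (u : T V) i j k :
  0 < occ ((i, j), k) (subst (inst_subst (nt_word B) s nu) u) <->
  (i != B /\ 0 < occ ((i, j), k) u) \/
  (exists j' k' k'', [/\ 0 < occ ((B, j'), k') u,
     0 < occ ((i, j), k'') (tnth (s k') j') & k = nu k' k'']).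
Proof.
rewrite occ_subst; split.
  move=> [[[i' j'] k'] h1]; rewrite inst_substE /=; case: eqP => [iB|ne].
    rewrite /rename => /occ_subst[[[i2 j2] k2] h2 /=].
    case: eqP => // -[? ? ?] _; subst; right; exists j', k', k2; split=> //.
  by rewrite /=; case: eqP => // -[? ? ?] _; subst; left; split=> //; apply/eqP.
case=> [[ne h]|[j' [k' [k'' [h1 h2 ->]]]]].
  by exists ((i, j), k) => //; rewrite inst_substE /= (negPf ne) /= eqxx.
exists ((B, j'), k') => //; rewrite inst_substE /= eqxx /rename.
by apply/occ_subst; exists ((i, j), k'') => //=; rewrite eqxx.
Qed.

Lemma occw_wprod1 n B (t : tw n) s nu i j k :
  0 < occw ((i, j), k) [tuple subst (inst_subst (nt_word B) s nu) (tnth t j) | j < n] <->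
  (i != B /\ 0 < occw ((i, j), k) t) \/
  (exists j' k' k'', [/\ 0 < occw ((B, j'), k') t,
     0 < occ ((i, j), k'') (tnth (s k') j') & k = nu k' k'']).
Proof.
split.
  move=> /occw_gt0[l]; rewrite tnth_mktuple => /occ_inst_subst[[ne h]|].
    by left; split=> //; apply/occw_gt0; exists l.
  move=> [j' [k' [k'' [h1 h2 h3]]]]; right; exists j', k', k''; split=> //.
  by apply/occw_gt0; exists l.
case=> [[ne /occw_gt0[l h]]|[j' [k' [k'' [/occw_gt0[l h1] h2 h3]]]]];
  apply/occw_gt0; exists l; rewrite tnth_mktuple; apply/occ_inst_subst.
  by left.
by right; exists j', k', k''.
Qed.

Lemma typed_relevant B (t : tw m) i j k j' :
  complete t -> typed B t -> 0 < occ ((i, j), k) (tnth t j') ->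
  exists j1 j2, relevant B j1 /\ 0 < occ ((i, j2), k) (tnth t j1).
Proof.
move=> ct ty h; have [j2 r2] := relevant_ex i.
have /ct : has_inst i k t by exists j; apply/occw_gt0; exists j'.
move=> /(_ _ r2) /occw_gt0[j1 h1]; exists j1, j2; split=> //.
by rewrite -(ty _ _ h1).
Qed.

Lemma wprod_invariant n (L : set (tw n)) B M :
  (forall t, L t -> complete t /\ clean t) ->
  (forall t, M t -> complete t /\ typed B t) ->
  forall t, wprod L (nt_word B) M t -> complete t /\ clean t.
Proof.
move=> hL hM t' [t Lt [s [nu [hs nuI nuD ->]]]].
have [ct dt] := hL _ Lt; split.
  move=> i k j [j0 /occw_wprod1]; case=> [[ne h]|[j' [k' [k'' [h1 h2 ->]]]]] rj.
    by apply/occw_wprod1; left; split=> //; apply: ct => //; exists j0.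
  have [|cs ts] := hM (s k'); first by apply/hs/has_instanceE; exists j'.
  have /cs/(_ rj) : has_inst i k'' (s k') by exists j0; apply/occw_gt0; exists j'.
  move=> /occw_gt0[j1 h3]; apply/occw_wprod1; right; exists j1, k', k''; split=> //.
  by apply: ct; [exists j'|rewrite -(ts _ _ h3)].
move=> [[i j] k] /occw_wprod1 [[ne h]|[j' [k' [k'' [h1 h2 ->]]]]]; first exact: (dt _ h).
have [|cs ts] := hM (s k'); first by apply/hs/has_instanceE; exists j'.
by rewrite /= (ts _ _ h2); exact: (dt _ h1).
Qed.

Lemma wprod_typed i0 (L : set (tw m)) B M :
  (forall t, L t -> clean t /\ typed i0 t) ->
  (forall t, M t -> typed B t) ->
  forall t, wprod L (nt_word B) M t -> typed i0 t.
Proof.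
move=> hL hM t' [t Lt [s [nu [hs nuI nuD ->]]]] l [[i j] k].
have [dt tt] := hL _ Lt; rewrite tnth_mktuple.
move=> /occ_inst_subst[[ne h]|[j' [k' [k'' [h1 h2 h3]]]]]; first exact: tt h.
have ts : typed B (s k').
  by apply/hM/hs/has_instanceE; exists j'; apply/occw_gt0; exists l.
by rewrite /= (ts _ _ h2) /= -(tt _ _ h1) .
Qed.

(** The product of languages is the composition of their semantics: an instance of [B] takes the
    value of the word substituted for it. *)
Lemma sem_wprod n (L : set (tw n)) B M rho :
  (forall t, L t -> complete t) ->
  (forall t, M t -> complete t /\ typed B t) ->
  sem (wprod L (nt_word B) M) rho = sem L (update rho B (sem M rho)).
Proof.
move=> hL hM; apply/seteqP; split=> w.
  move=> [_ [a [[t Lt [s [nu [hs nuI nuD ->]]]] ha ->]]].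
  pose a1 k i' k' := a i' (nu k k').
  exists t, (fun i k => if i == B then evaluate (a1 k) (s k) else a i k); split=> //.
    move=> i k hi; rewrite /update; case: (i =P B) hi => [->|ne] hi.
      have Ms : M (s k) by apply/hs/has_instanceE.
      have [cs ts] := hM _ Ms.
      (* An instance of [s k] that appears only in components dropped by [t] would be unconstrained;
         [typed_relevant] finds it in a component that [t] keeps. *)
      exists (s k), (a1 k); split=> // i' k' [j' /occw_gt0[j1 h1]].
      have [j2 [j3 [r2 h3]]] := typed_relevant cs ts h1.
      apply: ha; exists j3; apply/occw_wprod1; right; exists j2, k, k'; split=> //.
      exact: (hL _ Lt).
    case: hi => j hj; apply: ha; exists j; apply/occw_wprod1; left; split=> //.
    exact/eqP.
  apply: eq_from_tnth => j; rewrite !tnth_mktuple subst_comp.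
  apply: subst_ext => -[[i j'] k]; rewrite inst_substE /= {2}/assign /=; case: eqP => // _.
  by rewrite subst_rename tnth_mktuple; apply: subst_ext => -[[i2 j2] k2].
move=> [t [a [Lt ha ->]]].
have [j0 _] := relevant_ex B.
have /choice[p hp] : forall k, exists p : tw m * (I -> nat -> gtup m),
   has_inst B k t -> [/\ M p.1, forall i k', has_inst i k' p.1 -> rho i (p.2 i k') &
       a B k = evaluate p.2 p.1].
  move=> k; case: (EM (has_inst B k t)) => [h|nB].
    by have := ha _ _ h; rewrite /update eqxx => -[s [b hb]]; exists (s, b).
  by exists (word_of ar (nt_word B), a).
have [N hN] := number_bound t.
(* Numbers below [N] remain those of [t]. The number [N + pickle (k, k')] codes the instance [k'] of
   the word chosen for the instance [k] of [B], and [a'] decodes it. *)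
pose nu (i k : nat) := N + pickle (i, k).
pose a' i n' := if n' < N then a i n' else
  if unpickle (n' - N) is Some q then (p q.1).2 i q.2 else a i n'.
have a'nu i k k' : a' i (nu k k') = (p k).2 i k'.
  by rewrite /a' /nu ltnNge leq_addr /= addKn pickleK.
have a't i j k : 0 < occw ((i, j), k) t -> a' i k = a i k.
  by move=> /hN /= h; rewrite /a' h.
exists [tuple subst (inst_subst (nt_word B) (fun k => (p k).1) nu) (tnth t j) | j < n], a'.
split.
- exists t => //; exists (fun k => (p k).1), nu; split=> //.
  + by move=> k /has_instanceE/hp[].
  + by move=> i k i' k' /addnI /(pcan_inj pickleK) [].
  + by move=> y k _ /hN /= kN i j e; rewrite -e ltnNge leq_addr in kN.
- move=> i k [j /occw_wprod1[[ne h]|[j' [k' [k'' [h1 h2 ->]]]]]].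
    rewrite (a't _ _ _ h); have := ha i k; rewrite /update (negPf ne); apply.
    by exists j.
  rewrite a'nu; have [|_ + _] := hp k'; first by exists j'.
  by apply; exists j; apply/occw_gt0; exists j'.
- apply: eq_from_tnth => j; rewrite !tnth_mktuple subst_comp.
  apply: eq_in_subst => -[[i j'] k] h; rewrite inst_substE /=.
  have hw : 0 < occw ((i, j'), k) t by apply/occw_gt0; exists j.
  case: eqP => [iB|ne]; last by rewrite /assign /= (a't _ _ _ hw).
  rewrite subst_rename /assign /= iB; have [|_ _ ->] := hp k.
    by exists j'; rewrite -iB.
  rewrite tnth_mktuple; apply: subst_ext => -[[i2 j2] k2].
  by rewrite /= /assign /= a'nu.
Qed.

(** * Grammars and elimination of nonterminals *)

Variable prod : I -> set (tw m).
Hypothesis prod_finite : forall i, finite_set (prod i).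
Hypothesis prod_numbered : forall i t, prod i t -> numbered t.
Hypothesis prod_ok : forall i t, prod i t -> [/\ complete t, clean t & typed i t].

(** The nonterminals of [E] are expanded by productions, the others are parameters read in [rho].
    Elimination moves them one at a time from [rho] to [E]. *)
Inductive Gen (E : pred I) (rho : I -> set (gtup m)) : I -> gtup m -> Prop :=
| Gen_intro i t a : prod i t ->
    (forall j k, has_inst j k t -> E j -> Gen E rho j (a j k)) ->
    (forall j k, has_inst j k t -> ~~ E j -> rho j (a j k)) ->
    Gen E rho i (evaluate a t).

Lemma update_update rho B S S' : update (update rho B S) B S' = update rho B S'.
Proof. by apply/funext => i; rewrite /update; case: eqP. Qed.

Lemma wpow_ok B (L : set (tw m)) k :
  (forall t, L t -> [/\ complete t, clean t & typed B t]) ->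
  forall t, wpow L (nt_word B) k t -> complete t /\ typed B t.
Proof.
move=> hL; elim: k => [|k IH] /= t.
  move=> ->; split.
    move=> i k j [j0 /occw_gt0[l]]; rewrite tnth_mktuple tnth_mktuple /=.
    case: eqP => // -[-> _ ->] _ _; apply/occw_gt0; exists j.
    by rewrite !tnth_mktuple /= eqxx.
  by move=> j [[i j'] k]; rewrite !tnth_mktuple /=; case: eqP => // -[-> -> _].
move=> h; split.
  apply: (wprod_invariant _ IH h).1 => t' /hL[]; by split.
apply: (wprod_typed _ _ h); last by move=> t' /IH[].
by move=> t' /hL[].
Qed.

(** The exponent 0 is left out because [nt_word B] displays the irrelevant components of [B] as
    well. From exponent 1 on, cleanness is inherited from [L]. *)
Lemma wpowS_ok B (L : set (tw m)) k :
  (forall t, L t -> [/\ complete t, clean t & typed B t]) ->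
  forall t, wpow L (nt_word B) k.+1 t -> [/\ complete t, clean t & typed B t].
Proof.
move=> hL t h; have [c ty] := wpow_ok hL h; split=> //.
by apply: (wprod_invariant _ (wpow_ok (k:=k) hL) h).2 => t' /hL[].
Qed.

Section Step.
Variables (B : I) (L : set (tw m)) (rho : I -> set (gtup m)).
Hypothesis L_ok : forall t, L t -> [/\ complete t, clean t & typed B t].

(** These are the Kleene iterates, from the empty set, of the operator
    [S |-> sem L (update rho B S)]. *)
Definition iterate k := sem (wpow L (nt_word B) k) (update rho B set0).
(** Substituting the empty language for [B] keeps the words without [B]. *)
Definition closedstar := wprod (wstar L (nt_word B)) (nt_word B) set0.

(** Only the word of exponent 0 may fail to be clean, and the filter removes it since it contains
    [B]. *)
Lemma closedstar_ok t : closedstar t -> [/\ complete t, clean t & typed B t].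
Proof.
rewrite /closedstar wprod_set0 => -[[[|k] _ h] hB]; last exact: wpowS_ok h.
have [j _] := relevant_ex B.
case: (hB 0); rewrite h; exists j; apply/occw_gt0; exists j.
by rewrite !tnth_mktuple /= eqxx.
Qed.

Lemma sem_set0 n (L' : set (tw n)) : sem (wprod L' (nt_word B) set0) rho = sem L' (update rho B set0).
Proof.
rewrite wprod_set0; apply/seteqP; split=> w [t [a [ht ha ->]]]; exists t, a.
  case: ht => Lt hB; split=> // i k hi; rewrite /update; case: eqP hi => [->|_ hi].
    by move/hB.
  exact: ha.
split=> //; first by split=> // k /ha; rewrite /update eqxx.
by move=> i k /ha; rewrite /update; case: eqP.
Qed.

Lemma sem_closedstar : sem closedstar rho = \bigcup_k iterate k.
Proof.
rewrite sem_set0; apply/seteqP; split=> w.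
  by move=> [t [a [[k _ ht] ha ->]]]; exists k => //; exists t, a.
by move=> [k _ [t [a [ht ha ->]]]]; exists t, a; split=> //; exists k.
Qed.

Lemma iterate0 : iterate 0 = set0.
Proof.
apply/seteqP; split=> // w [_ [a [-> + _]]]; have [j _] := relevant_ex B.
move=> /(_ B 0); rewrite /update eqxx; apply.
by exists j; apply/occw_gt0; exists j; rewrite !tnth_mktuple /= eqxx.
Qed.

Lemma iterateS k : iterate k.+1 = sem L (update rho B (iterate k)).
Proof.
rewrite /iterate /= sem_wprod; first by rewrite update_update.
  by move=> t /L_ok[].
exact: wpow_ok.
Qed.

Lemma iterate_mono j k : j <= k -> iterate j `<=` iterate k.
Proof.
have S l : iterate l `<=` iterate l.+1.
  elim: l => [|l IH]; first by rewrite iterate0 => w.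
  rewrite [X in X `<=` _]iterateS [X in _ `<=` X]iterateS; apply: sem_mono => // i.
  by rewrite /update; case: eqP => _ w //; exact: IH.
move=> jk; rewrite -(subnK jk); elim: (k - j) => [|d IH] //.
by rewrite addSn; apply: subset_trans IH (S _).
Qed.

(** Continuity of the operator: a word has finitely many instances of [B], so their values all
    appear at one finite stage. *)
Lemma iterate_limit : sem L (update rho B (\bigcup_k iterate k)) `<=` \bigcup_k iterate k.
Proof.
move=> _ [t [a [Lt ha ->]]]; have [N hN] := number_bound t.
have [K hK] : exists K, forall k, k < N -> has_inst B k t -> iterate K (a B k).
  elim: {hN} N => [|N [K hK]]; first by exists 0.
  have [[k h]|no] := EM (exists k, has_inst B N t -> iterate k (a B N)).
    exists (maxn K k) => l; rewrite ltnS leq_eqVlt => /orP[/eqP->|lN] hi.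
      exact: iterate_mono (leq_maxr _ _) _ (h hi).
    exact: iterate_mono (leq_maxl _ _) _ (hK _ lN hi).
  case: no; case: (EM (has_inst B N t)) => [hi|]; last by exists 0.
  by have := ha _ _ hi; rewrite /update eqxx => -[k _ hk]; exists k.
exists K.+1 => //; rewrite iterateS; exists t, a; split=> // i k hi.
have := ha _ _ hi; rewrite /update; case: eqP => // iB _; rewrite iB in hi *.
by apply: hK => //; case: hi => j /hN.
Qed.
End Step.

(** Gaussian elimination with Arden's rule: the star solves the equation of [B] in terms of the
    remaining parameters, and the solution is substituted in every equation. It is correct because
    the least fixpoint over [B :: s] is the one over [s] in which the parameter [B] is the limit of
    its iterates. *)
Lemma eliminate (s : seq I) : exists L : I -> set (tw m),
  [/\ forall i, Rat (L i),
      forall i t, L i t -> [/\ complete t, clean t & typed i t] &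
      forall i rho, sem (L i) rho = Gen (fun j => j \in s) rho i].
Proof.
elim: s => [|B s [L [RL okL semL]]].
  exists prod; split=> //.
    by move=> i; apply: Rat_finite => // t; exact: prod_numbered.
  move=> i rho; apply/seteqP; split=> w.
    by move=> [t [a [pt ha ->]]]; apply: (Gen_intro pt) => [j k hi|j k hi _] //; exact: ha.
  case=> {i w} i t a pt _ ha; exists t, a; split=> // j k hi; exact: ha.
pose N := closedstar B (L B).
have okN t : N t -> complete t /\ typed B t.
  by move=> /(closedstar_ok (okL B))[].
exists (fun i => wprod (L i) (nt_word B) N); split.
- move=> i; apply: Rat_prod => //; first exact: uniq_nt_word.
  apply: Rat_prod; first exact: uniq_nt_word.
    by apply: Rat_star => //; exact: uniq_nt_word.
  by apply: Rat_finite => //; exact: finite_set0.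
- move=> i t h; have [|c d] := wprod_invariant _ okN h.
    by move=> t' /okL[].
  split=> //; apply: (wprod_typed _ _ h); last by move=> t' /okN[].
  by move=> t' /okL[].
move=> i rho; rewrite sem_wprod //; last by move=> t /okL[].
rewrite (sem_closedstar _ _) semL.
set it := \bigcup_k _.
have transfer S : S `<=` Gen (fun i => i \in B :: s) rho B ->
    forall j w, Gen (fun i => i \in s) (update rho B S) j w ->
      Gen (fun i => i \in B :: s) rho j w.
  move=> sub j w; elim=> {j w} j t a pt _ IH1 h2; apply: Gen_intro pt _ _.
    move=> j' k' hi; rewrite inE => /orP[/eqP jB|js]; last exact: IH1 hi js.
    (* [s] is any list and may already contain [B]; then [update] is not consulted for it. *)
    case js : (j' \in s); first exact: IH1 hi js.
    by have := h2 _ _ hi; rewrite js jB /update eqxx => /(_ isT)/sub.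
  move=> j' k' hi; rewrite inE negb_or => /andP[jB js].
  by have := h2 _ _ hi js; rewrite /update (negPf jB).
have sub k : iterate B (L B) rho k `<=` Gen (fun i => i \in B :: s) rho B.
  elim: k => [|k IH]; first by rewrite iterate0 => w.
  rewrite iterateS ?semL; last exact: okL.
  by move=> w; apply: transfer.
apply/seteqP; split=> w.
  by apply: transfer => w' [k _ /sub].
elim=> {i w} i t a pt _ IH1 h2; apply: Gen_intro pt _ _.
  by move=> j' k' hi js; apply: IH1 => //; rewrite inE js orbT.
move=> j' k' hi js; rewrite /update; case: eqP => [jB|jB].
  rewrite jB in hi *; apply: (iterate_limit (okL B)); rewrite semL.
  by apply: IH1; rewrite // inE eqxx.
by apply: h2; rewrite // inE negb_or js andbT; apply/eqP.
Qed.

(** The filter of [wprod_set0], applied once for each nonterminal. *)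
Lemma Rat_closed n (L : set (tw n)) :
  Rat L -> Rat [set t | L t /\ forall i k, ~ has_inst i k t].
Proof.
move=> RL; have {}RL (s : seq I) : Rat [set t | L t /\ forall i k, i \in s -> ~ has_inst i k t].
  elim: s => [|B s IH].
    by rewrite (_ : [set t | _] = L) //; apply/seteqP; split=> [t []|].
  have := Rat_prod (uniq_nt_word B) IH (Rat_finite (@finite_set0 (tw m)) _).
  rewrite wprod_set0 => h; rewrite (_ : [set t | _] = [set t | [set t | L t /\ forall i k, i \in s -> ~ has_inst i k t] t /\ forall k, ~ has_inst B k t]).
    by apply: h.
  apply/seteqP; split=> t.
    move=> [Lt h1]; split; last by move=> k; apply: h1; rewrite inE eqxx.
    by split=> // i k si; apply: h1; rewrite inE si orbT.
  by move=> [[Lt h1] h2]; split=> // i k; rewrite inE => /orP[/eqP->|/h1].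
have := RL (enum I); rewrite (_ : [set t | _] = [set t | L t /\ forall i k, ~ has_inst i k t]) //.
apply/seteqP; split=> t [Lt h]; split=> // i k.
by apply: h; rewrite mem_enum.
Qed.

(** With every parameter empty, only the words without instances have a value, and that value is the
    word itself. [g0] fills the assignment used to evaluate them. *)
Theorem Rat_Gen n (g0 : T void) (t0 : tw n) i0 :
  numbered t0 -> complete t0 -> (forall i k, has_inst i k t0 -> i = i0) ->
  Rat [set [tuple of_ground V (tnth w j) | j < n] |
        w in [set evaluate a t0 | a in [set a | forall k, has_inst i0 k t0 ->
                 Gen predT (fun=> set0) i0 (a i0 k)]]].
Proof.
move=> nt ct it; have [L [RL okL semL]] := eliminate (enum I).
have mE j : j \in enum I by rewrite mem_enum.
have GE : Gen (fun j => j \in enum I) (fun=> set0) i0 `<=` Gen predT (fun=> set0) i0 /\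
  Gen predT (fun=> set0) i0 `<=` Gen (fun j => j \in enum I) (fun=> set0) i0.
  move: {it} i0 => i; split=> w; elim=> {i w} i t a pt _ IH h2; apply: Gen_intro pt _ _.
  - by move=> j k hi _; apply: IH; rewrite // mE.
  - by move=> j k hi.
  - by move=> j k hi _; apply: IH.
  - by move=> j k hi; rewrite mE.
pose K := wprod [set t0] (nt_word i0) (L i0).
have RK : Rat K.
  apply: Rat_prod => //; first exact: uniq_nt_word.
  by apply: Rat_finite => [|t ->]; [exact: finite_set1|].
have semK : sem K (fun=> set0) = [set evaluate a t0 | a in [set a | forall k, has_inst i0 k t0 ->
                 Gen predT (fun=> set0) i0 (a i0 k)]].
  rewrite sem_wprod; [|by move=> t ->|by move=> t /okL[]].
  rewrite semL; apply/seteqP; split=> w.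
    move=> [_ [a [-> ha ->]]]; exists a => // k hi; apply: GE.1.
    by have := ha _ _ hi; rewrite /update eqxx.
  move=> [a ha <-]; exists t0, a; split=> // i k hi.
  have e := it _ _ hi; rewrite e in hi *; rewrite /update eqxx; apply: GE.2.
  exact: ha.
have gE (t : tw n) a : (forall i k, ~ has_inst i k t) ->
    [tuple of_ground V (tnth (evaluate a t) j) | j < n] = t.
  move=> hn; apply: eq_from_tnth => j; rewrite !tnth_mktuple /of_ground /rename.
  rewrite subst_comp -[RHS]subst_var; apply: eq_in_subst => -[[i j'] k] h.
  by case: (hn i k); exists j'; apply/occw_gt0; exists j.
rewrite -semK (_ : [set _ | w in _] = [set t | K t /\ forall i k, ~ has_inst i k t]).
  exact: Rat_closed.
apply/seteqP; split=> t.
  move=> [w [t1 [a [Kt ha ->]]] <-].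
  have hn : forall i k, ~ has_inst i k t1 by move=> i k /ha.
  by rewrite gE.
move=> [Kt hn]; exists (evaluate (fun _ _ => [tuple g0 | _ < m]) t); last by rewrite gE.
by exists t, (fun _ _ => [tuple g0 | _ < m]); split=> // i k /hn.
Qed.
End Kleene.

(** * Predecessors and successors of regular languages *)

Section Steps.
Variables (F : finType) (ar : F -> nat) (V : Type).
Local Notation T := (term ar).

Definition setarg f (a : {ffun 'I_(ar f) -> T V}) i b : {ffun 'I_(ar f) -> T V} :=
  [ffun j => if j == i then b else a j].

Inductive cstep (base : T V -> T V -> Prop) : T V -> T V -> Prop :=
| cstep_root l r : base l r -> cstep base l r
| cstep_arg f (a : {ffun 'I_(ar f) -> T V}) i b :
    cstep base (a i) b -> cstep base (App f a) (App f (setarg a i b)).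

Definition csteps base : T V -> T V -> Prop := clos_refl_trans _ (cstep base).

Lemma setarg_id f (a : {ffun 'I_(ar f) -> T V}) i : setarg a i (a i) = a.
Proof. by apply/ffunP => j; rewrite ffunE; case: eqP => // ->. Qed.

Lemma setarg_set f (a : {ffun 'I_(ar f) -> T V}) i b c :
  setarg (setarg a i b) i c = setarg a i c.
Proof. by apply/ffunP => j; rewrite !ffunE; case: eqP. Qed.

Lemma csteps_arg base f (a : {ffun 'I_(ar f) -> T V}) i b :
  csteps base (a i) b -> csteps base (App f a) (App f (setarg a i b)).
Proof.
move=> h; rewrite -{1}(setarg_id a i).
elim: h => {b} [s t st|s|s t u _ IH1 _ IH2]; [|exact: rt_refl|exact: rt_trans IH1 IH2].
apply: rt_step; rewrite -(setarg_set a i s t); apply: cstep_arg.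
by rewrite ffunE eqxx.
Qed.

Lemma csteps_app base f (a b : {ffun 'I_(ar f) -> T V}) :
  (forall i, csteps base (a i) (b i)) -> csteps base (App f a) (App f b).
Proof.
move=> h.
have H (s : seq 'I_(ar f)) :
    csteps base (App f a) (App f [ffun j => if j \in s then b j else a j]).
  elim: s => [|i s IH].
    by rewrite (_ : finfun _ = a); [exact: rt_refl|apply/ffunP => j; rewrite ffunE].
  apply: (rt_trans _ _ _ _ _ IH); set c := finfun _ in IH *.
  rewrite (_ : finfun _ = setarg c i (b i)).
    apply: csteps_arg; rewrite ffunE; case: ifP => _; [exact: rt_refl|exact: h].
  by apply/ffunP => j; rewrite !ffunE inE; case: eqP => // ->.
have := H (enum 'I_(ar f)); rewrite (_ : finfun _ = b) //.
by apply/ffunP => j; rewrite ffunE mem_enum.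
Qed.

Lemma csteps_flip base s t :
  csteps base s t -> csteps (fun x y => base y x) t s.
Proof.
elim=> {s t} [s t st|s|s t u _ IH1 _ IH2]; [|exact: rt_refl|exact: rt_trans IH2 IH1].
apply: rt_step; elim: st => {s t} [l r h|f a i b _ IH]; first exact: cstep_root.
rewrite -{2}(setarg_id a i) -(setarg_set a i b (a i)).
by apply: cstep_arg; rewrite ffunE eqxx.
Qed.

End Steps.

Section Saturation.
Variables (F : finType) (ar : F -> nat) (V : Type) (Q : Type).
Local Notation T := (term ar).

(** Transitions are propositions, unlike those of [automaton], because the ones added for
    predecessors are defined by the existence of derivations. *)
Inductive run (vt : V -> Q -> Prop)
    (at_ : forall f : F, {ffun 'I_(ar f) -> Q} -> Q -> Prop) : T V -> Q -> Prop :=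
| run_var v q : vt v q -> run vt at_ (Var v) q
| run_app f (a : {ffun 'I_(ar f) -> T V}) (qs : {ffun 'I_(ar f) -> Q}) q :
    (forall i, run vt at_ (a i) (qs i)) -> at_ f qs q -> run vt at_ (App f a) q.

Lemma run_varE vt at_ v q : run vt at_ (Var v) q <-> vt v q.
Proof.
split; last exact: run_var.
by move E: (Var v) => t h; case: h E => // v' q' h [->].
Qed.

Lemma run_appE vt at_ f a q : run vt at_ (App f a) q <->
  exists2 qs : {ffun 'I_(ar f) -> Q}, (forall i, run vt at_ (a i) (qs i)) & at_ f qs q.
Proof.
split; last by move=> [qs h1 h2]; exact: run_app h1 h2.
move E: (App f a) => t h; case: h E => // f' a' qs q' h1 h2 E.
have ff : f' = f by case: E.
subst f'; exists qs => // i; by rewrite (App_inj E).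
Qed.

Section Pre.
Variables (vt : V -> Q -> Prop) (at_ : forall f : F, {ffun 'I_(ar f) -> Q} -> Q -> Prop).
Variable W : Q -> Q -> Prop.

Definition rule_base (l r : T V) : Prop :=
  exists q1 q2, [/\ W q1 q2, run vt at_ l q1 & run vt at_ r q2].

(** The table [leads] replaces the usual saturation: it refers to the
    derivations themselves, which is enough to see that the language is regular. *)
Definition leads p q : Prop :=
  exists r t, [/\ run vt at_ r p, csteps rule_base r t & run vt at_ t q].

Definition pre_vt v q : Prop :=
  vt v q \/ exists q1 q2, [/\ W q1 q2, vt v q1 & leads q2 q].

Definition pre_at f (qs : {ffun 'I_(ar f) -> Q}) q : Prop :=
  at_ qs q \/ exists q1 q2, [/\ W q1 q2, at_ qs q1 & leads q2 q].

Lemma run_pre_sound t q : run pre_vt pre_at t q ->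
  exists2 t', csteps rule_base t t' & run vt at_ t' q.
Proof.
elim=> {t q} [v q|f a qs q _ IH].
  case=> [h|[q1 [q2 [w h [r [t [h1 h2 h3]]]]]]].
    by exists (Var v); [exact: rt_refl|exact: run_var].
  exists t => //; apply: rt_trans h2; apply/rt_step/cstep_root.
  by exists q1, q2; split=> //; exact: run_var.
have {}IH i : exists t', csteps rule_base (a i) t' /\ run vt at_ t' (qs i).
  by have [t' h1 h2] := IH i; exists t'.
have [b hb] := choice IH.
have ab : csteps rule_base (App f a) (App f (finfun b)).
  by apply: csteps_app => i; rewrite ffunE; exact: (hb i).1.
have rb i : run vt at_ (finfun b i) (qs i) by rewrite ffunE; exact: (hb i).2.
case=> [h|[q1 [q2 [w h [r [t [h1 h2 h3]]]]]]].
  by exists (App f (finfun b)) => //; exact: run_app h.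
exists t => //; apply: rt_trans ab _; apply: rt_trans h2; apply/rt_step/cstep_root.
by exists q1, q2; split=> //; exact: run_app h.
Qed.

Lemma run_sub t q : run vt at_ t q -> run pre_vt pre_at t q.
Proof.
elim=> {t q} [v q h|f a qs q _ IH h]; first by apply: run_var; left.
by apply: run_app IH _; left.
Qed.

(** A root step is absorbed by the last transition: soundness turns the run on the right-hand side
    into an entry of [leads], and this entry redirects the last transition of the run on the
    left-hand side to [q]. A deeper step is passed to the argument. *)
Lemma run_pre_step t t1 q :
  cstep rule_base t t1 -> run pre_vt pre_at t1 q -> run pre_vt pre_at t q.
Proof.
move=> h; elim: h q => {t t1} [l r [q1 [q2 [w hl hr]]]|f a i b _ IH] q.
  move=> /run_pre_sound[t' h1 h2].
  have ld : leads q2 q by exists r, t'.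
  case: hl w => {l} [v q1' h|f a qs q1' h1' h] w.
    by apply: run_var; right; exists q1', q2.
  apply/run_appE; exists qs => [i|]; first exact: run_sub.
  by right; exists q1', q2.
move=> /run_appE[qs h1 h2]; apply/run_appE; exists qs => // j.
by have := h1 j; rewrite ffunE; case: eqP => // -> /IH.
Qed.

Lemma run_preP t q : run pre_vt pre_at t q <->
  exists2 t', csteps rule_base t t' & run vt at_ t' q.
Proof.
split; first exact: run_pre_sound.
move=> [t' /clos_rt_rt1n_iff h]; elim: h => {t t'} [t|t t1 t2 st _ IH] h.
  exact: run_sub.
exact: run_pre_step st (IH h).
Qed.
End Pre.

(** The state type [Q] does not change, so a finite automaton yields a finite one. *)
Lemma pre_regular vt (at_ : forall f : F, {ffun 'I_(ar f) -> Q} -> Q -> Prop)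
    (W : Q -> Q -> Prop) : exists vt' at', forall t q, run vt' at' t q <->
  exists2 t', csteps (rule_base vt at_ W) t t' & run vt at_ t' q.
Proof. by eexists; eexists; exact: run_preP. Qed.

Lemma post_regular vt (at_ : forall f : F, {ffun 'I_(ar f) -> Q} -> Q -> Prop)
    (W : Q -> Q -> Prop) : exists vt' at', forall t q, run vt' at' t q <->
  exists2 t', csteps (rule_base vt at_ W) t' t & run vt at_ t' q.
Proof.
have [vt' [at' h]] := pre_regular vt at_ (fun q1 q2 => W q2 q1).
have flip : (fun x y => rule_base vt at_ W y x) = rule_base vt at_ (fun q1 q2 => W q2 q1).
  by apply/funext => x; apply/funext => y; apply/propext;
    split=> -[q1 [q2 [h1 h2 h3]]]; exists q2, q1.
exists vt', at' => t q; rewrite h; split=> -[t' h1 h2]; exists t' => //.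
  by have := csteps_flip h1; rewrite -flip.
by rewrite -flip; exact: csteps_flip.
Qed.

End Saturation.

Lemma run_restrict (F : finType) (ar : F -> nat) (V : eqType) (Q : Type) v0
    (vt : V -> Q -> Prop) (at_ : forall f : F, {ffun 'I_(ar f) -> Q} -> Q -> Prop) t q :
  run (fun v q => v != v0 /\ vt v q) at_ t q <-> run vt at_ t q /\ occ v0 t = 0.
Proof.
elim/term_rec_ffun: t q => [v|f a IH] q.
  rewrite !run_varE /=; split=> [[ne ?]|[? /eqP]].
    by split=> //; rewrite eq_sym (negPf ne).
  by rewrite eqb0 eq_sym.
rewrite !run_appE; split.
  move=> [qs h1 h2]; split; first by exists qs => // i; case/IH: (h1 i).
  by rewrite occ_App big1 // => i _; case/IH: (h1 i).
move=> [[qs h1 h2]] /eqP; rewrite occ_App sum_nat_eq0 => /forallP h3.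
by exists qs => // i; apply/IH; split=> //; apply/eqP/(implyP (h3 i)).
Qed.

(** * The linked closure is rational *)

Section Matches.
Variables (F : finType) (ar : F -> nat) (X : Type).
Local Notation T := (term ar).

(** The junk constant [None] stands for any ground term, chosen anew at each occurrence; hence a
    relation and not a substitution. *)
Fixpoint matches (s : X -> T void) (u : T (option X)) (t : T void) : Prop :=
  match u with
  | Var None => True
  | Var (Some x) => t = s x
  | App f a => exists2 b : {ffun 'I_(ar f) -> T void}, t = App f b & forall i, matches s (a i) (b i)
  end.
End Matches.

Lemma matches_ext (F : finType) (ar : F -> nat) (X : eqType) (s s' : X -> term ar void) u t :
  (forall x, 0 < occ (Some x) u -> s x = s' x) -> matches s u t -> matches s' u t.
Proof.
elim/term_rec_ffun: u t => [[x|]|f a IH] t h //=.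
  by move=> ->; apply: h; rewrite /= eqxx.
move=> [b -> hb]; exists b => // i; apply: IH (hb i) => x hx; apply: h.
exact: occ_arg_gt0 hx.
Qed.

Local Notation emptyset := finset.set0.

Section Linked.
Variables (F : finType) (ar : F -> nat) (X Q : finType).
Local Notation T := (term ar).
Variable vt : bool -> option X -> Q -> Prop.
Variable at_ : bool -> forall f : F, {ffun 'I_(ar f) -> Q} -> Q -> Prop.
Variable W : Q -> Q -> Prop.
Local Notation runs b := (run (vt b) (@at_ b)).

(** The two patterns have the same variables: those of [u] that a derivation erases appear here as
    junk. *)
Inductive linked : T void -> T void -> Prop :=
| linked_cong f (a b : {ffun 'I_(ar f) -> T void}) :
    (forall i, linked (a i) (b i)) -> linked (App f a) (App f b)
| linked_rule q1 q2 u v s1 s2 t1 t2 :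
    W q1 q2 -> runs true u q1 -> runs false v q2 ->
    (forall x, occ (Some x) u = occ (Some x) v) ->
    (forall x, occ (Some x) v <= 1) ->
    matches s1 u t1 -> matches s2 v t2 -> (forall x, linked (s1 x) (s2 x)) ->
    linked t1 t2.

Lemma linked_refl t : linked t t.
Proof. by elim/term_rec_ffun: t => // f a IH; exact: linked_cong. Qed.

(** A configuration [c] describes a pair of terms under construction, with the
    left one ([true]) read by [runs true] and the right one by [runs false]: the
    slot [(b, Z)] with [c (b, Z) = Some q] is a pending subterm of side [b] in
    which exactly the variables of [Z] occur and which reaches the state [q].
    Pending sets are nonempty and disjoint on each side, so [Z] identifies the
    subterm; subterms without variables are generated apart, from [NTrun].
    All the nonterminals are tuples indexed by the slots, with a dummy ground
    term in the slots that they do not use. *)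
Local Notation Sl := (bool * {set X})%type.
Local Notation I := (option (option (bool * Q)) + {ffun Sl -> option Q})%type.
Local Notation m := #|{: Sl}|.
Local Notation V := (ivar (I * 'I_m)%type).

Definition NTlink : I := inl None.
Definition NTrun (o : option (bool * Q)) : I := inl (Some o).
Definition NTconf (c : {ffun Sl -> option Q}) : I := inr c.

Definition root_slot (b : bool) : Sl := (b, emptyset).

Definition nt_var (i : I) (sl : Sl) (k : nat) : V := ((i, enum_rank sl), k).

Lemma nt_var_inj i sl k i' sl' k' : nt_var i sl k = nt_var i' sl' k' -> [/\ i = i', sl = sl' & k = k'].
Proof. by move=> -[-> /enum_rank_inj -> ->]. Qed.

Lemma nt_varP (v : V) : exists i sl k, v = nt_var i sl k.
Proof. by case: v => [[i j] k]; exists i, (enum_val j), k; rewrite /nt_var enum_valK. Qed.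

Variable a0 : T void.

(** Productions read one symbol at a time, so no larger component is needed. *)
Inductive shape := Dead | Leaf of V | Node (f : F) of {ffun 'I_(ar f) -> V}.

Definition shape_term (S : shape) : T V :=
  match S with
  | Dead => of_ground V a0
  | Leaf v => Var v
  | Node f h => App f [ffun i => Var (h i)]
  end.

Definition shape_var (S : shape) (v : V) : Prop :=
  match S with
  | Dead => False
  | Leaf w => w = v
  | Node f h => exists i, h i = v
  end.

Definition shape_value (al : V -> T void) (S : shape) : T void :=
  match S with
  | Dead => a0
  | Leaf v => al v
  | Node f h => App f [ffun i => al (h i)]
  end.

Lemma shape_valueE al S : subst al (shape_term S) = shape_value al S.
Proof.
case: S => [|v|f h] //=; first exact: subst_to_ground.
by congr App; apply/ffunP => i; rewrite !ffunE.
Qed.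

Lemma occ_shape v S : 0 < occ v (shape_term S) <-> shape_var S v.
Proof.
case: S => [|w|f h] /=.
- split=> //; rewrite /of_ground /rename => /occ_subst[] //.
- by split; [case: eqP|move=> ->; rewrite eqxx].
- split.
    rewrite occ_App_gt0 => /existsP[i]; rewrite ffunE /=; case: eqP => // -> _.
    by exists i.
  by move=> [i <-]; rewrite occ_App_gt0; apply/existsP; exists i; rewrite ffunE /= eqxx.
Qed.

Lemma sum_le1 (J : finType) (E : J -> nat) :
  (forall i, E i <= 1) -> (forall i j, 0 < E i -> 0 < E j -> i = j) -> \sum_i E i <= 1.
Proof.
move=> h1 h2; rewrite (eq_bigr (fun i => (0 < E i : nat))); first exact: sum_bool_le1.
by move=> i _; have := h1 i; case: (E i) => [|[|]].
Qed.

Definition word_of_shapes (g : Sl -> shape) : tword ar (I * 'I_m)%type m :=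
  [tuple shape_term (g (enum_val j)) | j < m].

Lemma occ_word g v : 0 < occw v (word_of_shapes g) <-> exists sl, shape_var (g sl) v.
Proof.
rewrite occw_gt0; split.
  by move=> [j]; rewrite tnth_mktuple => /occ_shape h; exists (enum_val j).
by move=> [sl h]; exists (enum_rank sl); rewrite tnth_mktuple enum_rankK; apply/occ_shape.
Qed.

Lemma word_numbered g :
  (forall sl f h, g sl = @Node f h -> injective h) ->
  (forall sl sl' v, shape_var (g sl) v -> shape_var (g sl') v -> sl = sl') ->
  numbered (word_of_shapes g).
Proof.
move=> hI hD v; apply: sum_le1 => [j|i j].
  rewrite tnth_mktuple; have := @hI (enum_val j); case: (g _) => [|w|f h] /= inj.
  - rewrite leqNgt; apply/negP => /ltnW; rewrite /of_ground /rename => /occ_subst[] //.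
  - by case: (_ == _).
  - rewrite (eq_bigr (fun i => (v == h i : nat))); last by move=> i _; rewrite ffunE.
    by apply: sum_bool_le1 => i i' /eqP-> /eqP; exact: inj.
rewrite !tnth_mktuple => /occ_shape h1 /occ_shape h2.
by apply: enum_val_inj; exact: hD h1 h2.
Qed.

(** A configuration with nothing pending has no production; all its slots are declared relevant
    because every nonterminal must have a relevant component. *)
Definition relevant_slot (i : I) (sl : Sl) : bool :=
  match i with
  | inl None => (sl == root_slot true) || (sl == root_slot false)
  | inl (Some _) => sl == root_slot true
  | inr c => (c sl != None) || [forall sl', c sl' == None]
  end.

Definition relevant (i : I) : pred 'I_m := fun j => relevant_slot i (enum_val j).

Lemma relevant_ex i : exists j, relevant i j.
Proof.
case: i => [[o|]|c].
- by exists (enum_rank (root_slot true)); rewrite /relevant enum_rankK /= eqxx.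
- by exists (enum_rank (root_slot true)); rewrite /relevant enum_rankK /= eqxx.
- case h: [forall sl', c sl' == None].
    by exists (enum_rank (root_slot true)); rewrite /relevant /= h orbT.
  move/negbT: h; rewrite negb_forall => /existsP[sl h].
  by exists (enum_rank sl); rewrite /relevant enum_rankK /= h.
Qed.

Lemma word_complete g :
  (forall i k sl sl', shape_var (g sl) (nt_var i sl' k) -> forall sl2, relevant_slot i sl2 ->
     exists sl3, shape_var (g sl3) (nt_var i sl2 k)) ->
  complete relevant (word_of_shapes g).
Proof.
move=> h i k j [j0 /occ_word[sl hs]] rj; apply/occ_word.
have := h i k sl (enum_val j0); rewrite /nt_var enum_valK => /(_ hs (enum_val j) rj).
by rewrite enum_valK.
Qed.

Lemma word_clean g :
  (forall i k sl sl', shape_var (g sl) (nt_var i sl' k) -> relevant_slot i sl') -> clean relevant (word_of_shapes g).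
Proof.
by move=> h v /occ_word[sl]; have [i [sl' [k ->]]] := nt_varP v => /h; rewrite /relevant /= enum_rankK.
Qed.

Lemma word_typed i0 g :
  (forall i k sl sl', shape_var (g sl) (nt_var i sl' k) -> relevant_slot i sl') ->
  (forall sl v, shape_var (g sl) v -> relevant_slot i0 sl) -> typed relevant i0 (word_of_shapes g).
Proof.
move=> h1 h2 j v; rewrite tnth_mktuple => /occ_shape; have [i [sl' [k ->]]] := nt_varP v => h.
by rewrite /relevant /= enum_rankK (h1 _ _ _ _ h) (h2 _ _ h).
Qed.

(** Subterms without variables become independent instances numbered by [k], whereas all the pending
    slots share the instance 0 of [c], so that they are expanded jointly. *)
Definition place c b q (Z : {set X}) k : V :=
  if Z == emptyset then nt_var (NTrun (Some (b, q))) (root_slot true) k else nt_var (NTconf c) (b, Z) 0.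

Definition any_shape f (sl : Sl) : shape :=
  if sl == root_slot true then Node [ffun i : 'I_(ar f) => nt_var (NTrun None) (root_slot true) i] else Dead.

Definition run_shape b f (qs : {ffun 'I_(ar f) -> Q}) (sl : Sl) : shape :=
  if sl == root_slot true then Node [ffun i => nt_var (NTrun (Some (b, qs i))) (root_slot true) i] else Dead.

Definition junk_shape (sl : Sl) : shape :=
  if sl == root_slot true then Leaf (nt_var (NTrun None) (root_slot true) 0) else Dead.

Definition cong_shape f (sl : Sl) : shape :=
  if sl.2 == emptyset then Node [ffun i : 'I_(ar f) => nt_var NTlink sl i] else Dead.

Definition start_config q1 q2 Z : {ffun Sl -> option Q} :=
  [ffun sl => if (sl.2 == Z) && (Z != emptyset) then Some (if sl.1 then q1 else q2) else None].

Definition start_shape q1 q2 Z (sl : Sl) : shape :=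
  if sl.2 == emptyset then
    Leaf (place (start_config q1 q2 Z) sl.1 (if sl.1 then q1 else q2) Z 0)
  else Dead.

(** New slots take precedence over [s0]: an argument that carries all the variables of [s0] reuses
    its slot. The type [A] is generic since states, patterns and ground terms are all updated in
    this way. *)
Definition split_slot (A : Type) (s0 : Sl) f (Zs : {ffun 'I_(ar f) -> {set X}})
    (new : 'I_(ar f) -> A) (dflt : A) (old : Sl -> A) (sl : Sl) : A :=
  if [pick i | (sl == (s0.1, Zs i)) && (Zs i != emptyset)] is Some i then new i
  else if sl == s0 then dflt else old sl.

Definition split_config (c : {ffun Sl -> option Q}) (s0 : Sl) f (qs : {ffun 'I_(ar f) -> Q})
    (Zs : {ffun 'I_(ar f) -> {set X}}) : {ffun Sl -> option Q} :=
  [ffun sl => split_slot s0 Zs (fun i => Some (qs i)) None c sl].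

Definition split_shape (c : {ffun Sl -> option Q}) (s0 : Sl) f (qs : {ffun 'I_(ar f) -> Q})
    (Zs : {ffun 'I_(ar f) -> {set X}}) (sl : Sl) : shape :=
  if sl == s0 then Node [ffun i => place (split_config c s0 qs Zs) s0.1 (qs i) (Zs i) i]
  else if c sl is Some _ then Leaf (nt_var (NTconf (split_config c s0 qs Zs)) sl 0) else Dead.

(** Once all the pending subterms are variables, the two occurrences of each
    variable [x] become the two components of the instance [enum_rank x]. *)
Definition link_shape (c : {ffun Sl -> option Q}) (sl : Sl) : shape :=
  if c sl is Some _ then
    if [pick x | sl.2 == [set x]] is Some x then Leaf (nt_var NTlink (root_slot sl.1) (enum_rank x)) else Dead
  else Dead.

Definition split_ok (c : {ffun Sl -> option Q}) (s0 : Sl) f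
    (Zs : {ffun 'I_(ar f) -> {set X}}) : Prop :=
  (forall x, \sum_i (x \in Zs i : nat) = (x \in s0.2)) /\
  (forall i, Zs i != emptyset -> c (s0.1, Zs i) = None \/ (s0.1, Zs i) = s0).

Definition link_ok (c : {ffun Sl -> option Q}) : Prop :=
  [/\ exists sl, c sl != None,
      forall sl q, c sl = Some q -> exists2 x, sl.2 = [set x] & vt sl.1 (Some x) q &
      forall x, (c (true, [set x]) != None) = (c (false, [set x]) != None)].

Definition production (i : I) (g : Sl -> shape) : Prop :=
  match i with
  | inl None => (exists f, g = cong_shape f) \/
      (exists q1 q2 Z, W q1 q2 /\ g = start_shape q1 q2 Z)
  | inl (Some None) => exists f, g = any_shape f
  | inl (Some (Some (b, q))) =>
      (exists f (qs : {ffun 'I_(ar f) -> Q}), at_ b qs q /\ g = run_shape b qs) \/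
      (vt b None q /\ g = junk_shape)
  | inr c =>
      (exists s0 q f (qs : {ffun 'I_(ar f) -> Q}) Zs,
         [/\ c s0 = Some q, at_ s0.1 qs q, split_ok c s0 Zs & g = split_shape c s0 qs Zs]) \/
      (link_ok c /\ g = link_shape c)
  end.

Local Open Scope classical_set_scope.

Definition production_words (i : I) : set (tword ar (I * 'I_m)%type m) := word_of_shapes @` production i.

Lemma finite_set_image_of (A : finType) B (h : A -> B) (P : set B) :
  (forall b, P b -> exists a, b = h a) -> finite_set P.
Proof.
move=> hP; apply: (sub_finite_set (B := h @` setT)); last exact/finite_image/finite_finset.
by move=> b /hP[a ->]; exists a.
Qed.

Lemma production_words_finite i : finite_set (production_words i).
Proof.
apply: finite_image; case: i => [[[[b q]|]|]|c] /=.
- apply: (sub_finite_set (B := [set g | exists fq : {f : F & {ffun 'I_(ar f) -> Q}},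
      g = run_shape b (tagged fq)] `|` [set junk_shape])).
    move=> g [[f [qs [_ ->]]]|[_ ->]]; last by right.
    by left; exists (existT _ f qs).
  by rewrite finite_setU; split; [apply: finite_set_image_of => g [p ->]; exists p|exact: finite_set1].
- by apply: finite_set_image_of => g [f ->]; exists f.
- apply: (sub_finite_set (B := [set g | exists f, g = cong_shape f] `|`
      [set g | exists p : Q * Q * {set X}, g = start_shape p.1.1 p.1.2 p.2])).
    move=> g [h|[q1 [q2 [Z [_ ->]]]]]; first by left.
    by right; exists (q1, q2, Z).
  by rewrite finite_setU; split; apply: finite_set_image_of => g [x ->]; exists x.
- apply: (sub_finite_set (B := [set g | exists p : Sl * {f : F &
      ({ffun 'I_(ar f) -> Q} * {ffun 'I_(ar f) -> {set X}})%type},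
      g = split_shape c p.1 (tagged p.2).1 (tagged p.2).2] `|` [set link_shape c])).
    move=> g [[s0 [q [f [qs [Zs [_ _ _ ->]]]]]]|[_ ->]]; last by right.
    by left; exists (s0, existT _ f (qs, Zs)).
  by rewrite finite_setU; split; [apply: finite_set_image_of => g [p ->]; exists p|exact: finite_set1].
Qed.

Implicit Types (c : {ffun Sl -> option Q}) (sl : Sl).

Lemma relevant_NTlink sl : relevant_slot NTlink sl = (sl.2 == emptyset).
Proof. by case: sl => -[] Z; rewrite /= /root_slot !xpair_eqE /= ?andbF ?orbF. Qed.

Lemma root_slot_eta (sl : Sl) : sl.2 == emptyset -> sl = root_slot sl.1.
Proof. by case: sl => b Z /= /eqP->. Qed.

Lemma split_disjoint c s0 f (Zs : {ffun 'I_(ar f) -> {set X}}) x i j :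
  split_ok c s0 Zs -> x \in Zs i -> x \in Zs j -> i = j.
Proof.
move=> [h _] xi xj; apply/eqP; apply: contraT => ij.
have := h x; rewrite (bigD1 i) //= (bigD1 j) 1?eq_sym //= xi xj.
by case: (x \in _).
Qed.

Lemma split_new A c s0 f (Zs : {ffun 'I_(ar f) -> {set X}}) (new : _ -> A) dflt old i :
  split_ok c s0 Zs -> Zs i != emptyset -> split_slot s0 Zs new dflt old (s0.1, Zs i) = new i.
Proof.
move=> ok ne; rewrite /split_slot; case: pickP => [j /andP[/eqP[e] _]|/(_ i)]; last by rewrite eqxx ne.
by case/set0Pn: ne => x xi; rewrite (split_disjoint ok xi (j := j)) // -e.
Qed.

Lemma split_old A c s0 f (Zs : {ffun 'I_(ar f) -> {set X}}) (new : _ -> A) dflt old sl :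
  split_ok c s0 Zs -> sl != s0 -> c sl != None -> split_slot s0 Zs new dflt old sl = old sl.
Proof.
move=> ok ne cs; rewrite /split_slot; case: pickP => [i /andP[/eqP e nz]|_]; last by rewrite (negPf ne).
by case: (ok.2 i nz) => e2; rewrite e e2 eqxx in cs ne.
Qed.

Lemma split_config_new c s0 f (qs : {ffun 'I_(ar f) -> Q}) Zs i :
  split_ok c s0 Zs -> Zs i != emptyset -> split_config c s0 qs Zs (s0.1, Zs i) = Some (qs i).
Proof. by move=> ok ne; rewrite ffunE (split_new _ _ _ ok ne). Qed.

Lemma split_config_old c s0 f (qs : {ffun 'I_(ar f) -> Q}) Zs sl :
  split_ok c s0 Zs -> sl != s0 -> c sl != None -> split_config c s0 qs Zs sl = c sl.
Proof. by move=> ok ne cs; rewrite ffunE (split_old _ _ _ ok ne cs). Qed.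

Lemma split_config_inv c s0 f (qs : {ffun 'I_(ar f) -> Q}) Zs sl q :
  split_config c s0 qs Zs sl = Some q ->
  (exists i, [/\ sl = (s0.1, Zs i), Zs i != emptyset & q = qs i]) \/ (sl != s0 /\ c sl = Some q).
Proof.
rewrite ffunE /split_slot; case: pickP => [i /andP[/eqP e nz] [<-]|_]; first by left; exists i.
by case: eqP => // /eqP ne; right.
Qed.

Lemma relevant_NTconf c sl : c sl != None -> forall sl', relevant_slot (NTconf c) sl' = (c sl' != None).
Proof.
move=> h sl' /=; rewrite (_ : [forall _, _] = false) ?orbF //.
by apply/negbTE; rewrite negb_forall; apply/existsP; exists sl.
Qed.

(** The first two conditions give [numbered], the third gives [clean] and [typed], the fourth gives
    [complete]. *)
Definition wellformed (i0 : I) (g : Sl -> shape) : Prop :=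
  [/\ forall sl f h, g sl = @Node f h -> injective h,
      forall sl sl' v, shape_var (g sl) v -> shape_var (g sl') v -> sl = sl',
      forall i k sl sl', shape_var (g sl) (nt_var i sl' k) -> relevant_slot i sl' /\ relevant_slot i0 sl &
      forall i k sl sl', shape_var (g sl) (nt_var i sl' k) -> forall sl2, relevant_slot i sl2 ->
        exists sl3, shape_var (g sl3) (nt_var i sl2 k)].

Lemma Node_inj f (h h' : {ffun 'I_(ar f) -> V}) : Node h = Node h' -> h = h'.
Proof.
case=> e; apply: (inj_pair2_eq_dec F _ (fun f => {ffun 'I_(ar f) -> V})) => //.
by move=> x y; case: (x =P y); [left|right].
Qed.

Lemma Node_ffun_inj f (E : 'I_(ar f) -> V) f' h' :
  injective E -> Node (finfun E) = @Node f' h' -> injective h'.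
Proof.
move=> EI e; have ff : f' = f by case: e.
subst f'; rewrite -(Node_inj e) => i j; rewrite !ffunE; exact: EI.
Qed.

Lemma any_wellformed f : wellformed (NTrun None) (any_shape f).
Proof.
split.
- move=> sl f' h; rewrite /any_shape; case: eqP => // _; apply: Node_ffun_inj => i j.
  by move=> /nt_var_inj[_ _]; exact: val_inj.
- by move=> sl sl' v; rewrite /any_shape; case: (sl =P _) => // e; case: (sl' =P _) => // ->; rewrite e.
- move=> i k sl sl'; rewrite /any_shape; case: eqP => // -> [j].
  by rewrite ffunE => /nt_var_inj[<- <- _] /=.
- move=> i k sl sl'; rewrite {1}/any_shape; case: eqP => // _ [j].
  rewrite ffunE => /nt_var_inj[<- _ <-] sl2 /= /eqP->.
  by exists (root_slot true); rewrite /any_shape eqxx; exists j; rewrite ffunE.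
Qed.

Lemma run_wellformed b q f (qs : {ffun 'I_(ar f) -> Q}) : wellformed (NTrun (Some (b, q))) (run_shape b qs).
Proof.
split.
- move=> sl f' h; rewrite /run_shape; case: eqP => // _; apply: Node_ffun_inj => i j.
  by move=> /nt_var_inj[_ _]; exact: val_inj.
- by move=> sl sl' v; rewrite /run_shape; case: (sl =P _) => // e; case: (sl' =P _) => // ->; rewrite e.
- move=> i k sl sl'; rewrite /run_shape; case: eqP => // -> [j].
  by rewrite ffunE => /nt_var_inj[<- <- _] /=.
- move=> i k sl sl'; rewrite {1}/run_shape; case: eqP => // _ [j].
  rewrite ffunE => /nt_var_inj[<- _ <-] sl2 /= /eqP->.
  by exists (root_slot true); rewrite /run_shape eqxx; exists j; rewrite ffunE.
Qed.

Lemma junk_wellformed b q : wellformed (NTrun (Some (b, q))) junk_shape.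
Proof.
split.
- by move=> sl f' h; rewrite /junk_shape; case: eqP.
- by move=> sl sl' v; rewrite /junk_shape; case: (sl =P _) => // e; case: (sl' =P _) => // ->; rewrite e.
- move=> i k sl sl'; rewrite /junk_shape; case: eqP => // -> /=.
  by move=> /nt_var_inj[<- <- _] /=.
- move=> i k sl sl'; rewrite {1}/junk_shape; case: eqP => // _ /=.
  move=> /nt_var_inj[<- _ <-] sl2 /= /eqP->.
  by exists (root_slot true); rewrite /junk_shape eqxx.
Qed.

Lemma cong_wellformed f : wellformed NTlink (cong_shape f).
Proof.
split.
- move=> sl f' h; rewrite /cong_shape; case: eqP => // _; apply: Node_ffun_inj => i j.
  by move=> /nt_var_inj[_ _]; exact: val_inj.
- move=> sl sl' v; rewrite /cong_shape; case: eqP => // _; case: eqP => // _ /= [i <-] [j].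
  by rewrite !ffunE => /nt_var_inj[].
- move=> i k sl sl'; rewrite relevant_NTlink /cong_shape; case: eqP => // e [j].
  by rewrite ffunE => /nt_var_inj[<- <- _]; rewrite relevant_NTlink e.
- move=> i k sl sl'; rewrite {1}/cong_shape; case: eqP => // e [j].
  rewrite ffunE => /nt_var_inj[<- _ <-] sl2; rewrite relevant_NTlink => h.
  by exists sl2; rewrite /cong_shape h; exists j; rewrite ffunE.
Qed.

Lemma start_wellformed q1 q2 Z : wellformed NTlink (start_shape q1 q2 Z).
Proof.
split.
- by move=> sl f' h; rewrite /start_shape; case: eqP.
- move=> sl sl' v; rewrite /start_shape; case h: (sl.2 == _) => //.
  case h': (sl'.2 == _) => //= <-.
  rewrite (root_slot_eta h) (root_slot_eta h') /= /place; case: (Z == _) => /nt_var_inj; last by case=> _ [->].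
  by case=> -[->].
- move=> i k sl sl'; rewrite relevant_NTlink /start_shape; case h: (sl.2 == _) => //=; rewrite /place.
  case hZ: (Z == _) => /nt_var_inj[<- <- _]; first by rewrite /= eqxx.
  by split=> //; rewrite /= ffunE /= eqxx hZ.
- move=> i k sl sl'; rewrite {1}/start_shape; case h: (sl.2 == _) => //=; rewrite {1}/place.
  case hZ: (Z == _) => /nt_var_inj[ei e ek] sl2; rewrite -{}ei -{}ek.
    by move=> /= /eqP->; exists sl; rewrite /start_shape h /= /place hZ.
  rewrite (@relevant_NTconf _ (true, Z)); last by rewrite ffunE /= eqxx hZ.
  rewrite ffunE hZ andbT; case: sl2 => b Z2 /=; case e2: (Z2 == Z) => // _; move/eqP: e2 => ->.
  by exists (root_slot b); rewrite /start_shape eqxx /= /place hZ.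
Qed.

Lemma link_wellformed c : link_ok c -> wellformed (NTconf c) (link_shape c).
Proof.
move=> [[sl0 c0] h1 h2].
have E sl q : c sl = Some q -> exists2 x, link_shape c sl = Leaf (nt_var NTlink (root_slot sl.1) (enum_rank x)) &
    sl.2 = [set x]%SET.
  move=> e; rewrite /link_shape e; have [x ex _] := h1 _ _ e; exists x => //.
  case: pickP => [y /eqP|/(_ x)]; last by rewrite ex eqxx.
  by rewrite ex => /set1_inj->.
have inv sl v : shape_var (link_shape c sl) v -> exists x, [/\ sl = (sl.1, [set x]%SET), c sl != None &
    v = nt_var NTlink (root_slot sl.1) (enum_rank x)].
  case e: (c sl) => [q|]; last by rewrite /link_shape e.
  have [x -> ex] := E _ _ e => /= <-; exists x; split=> //.
  by rewrite -ex; case: (sl).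
split.
- by move=> sl f h; case e: (c sl) => [q|]; [have [x ->] := E _ _ e|rewrite /link_shape e].
- move=> sl sl' v /inv[x [-> _ ->]] /inv[y [-> _ /nt_var_inj[_ []]]] /=.
  by move=> -> /val_inj/enum_rank_inj ->.
- move=> i k sl sl' /inv[x [e cs /nt_var_inj[-> -> _]]]; split; first by rewrite relevant_NTlink.
  by rewrite (relevant_NTconf c0).
- move=> i k sl sl' /inv[x [e cs /nt_var_inj[-> _ ->]]] sl2; rewrite relevant_NTlink => h.
  have : c (sl2.1, [set x]%SET) != None.
    by have := h2 x; move: cs; rewrite e; case: (sl.1); case: (sl2.1) => //= cs ee;
      [rewrite -ee|rewrite ee].
  case ec: (c _) => [q|] // _; exists (sl2.1, [set x]%SET).
  have [y ->] := E _ _ ec; rewrite /= => /set1_inj ->.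
  by rewrite (root_slot_eta h).
Qed.

Lemma split_wellformed c s0 q f (qs : {ffun 'I_(ar f) -> Q}) Zs :
  c s0 = Some q -> split_ok c s0 Zs -> wellformed (NTconf c) (split_shape c s0 qs Zs).
Proof.
move=> cs0 ok; set c' := split_config c s0 qs Zs.
have inv sl v : shape_var (split_shape c s0 qs Zs sl) v ->
  [\/ exists i, [/\ sl = s0, Zs i = emptyset & v = nt_var (NTrun (Some (s0.1, qs i))) (root_slot true) i],
      exists i, [/\ sl = s0, Zs i != emptyset & v = nt_var (NTconf c') (s0.1, Zs i) 0] |
      [/\ sl != s0, c sl != None & v = nt_var (NTconf c') sl 0]].
  rewrite /split_shape; case: eqP => [->|/eqP ne] /=.
    move=> [i <-]; rewrite ffunE /place; case: ifP => [/eqP e|/negbT e].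
      by apply: Or31; exists i.
    by apply: Or32; exists i.
  by case e: (c sl) => [q'|] //= <-; apply: Or33.
have c'new i : Zs i != emptyset -> c' (s0.1, Zs i) = Some (qs i) by exact: split_config_new.
have c'old sl : sl != s0 -> c sl != None -> c' sl = c sl by exact: split_config_old.
split.
- move=> sl f' h; rewrite /split_shape; case: eqP => [_|_]; last by case: (c sl).
  apply: Node_ffun_inj => i j; rewrite /place.
  case: ifP => zi; case: ifP => zj /nt_var_inj[] //; first by move=> _ _ /val_inj.
  move=> _ [e] _; move/negbT/set0Pn: zi => [x xi]; apply: (split_disjoint ok xi).
  by rewrite -e.
(* The component at [s0] and another one can share only a configuration variable; a new slot would
   then be an old pending one, which [split_ok] forbids. *)
- have key sl sl' v : sl = s0 -> sl' != s0 -> shape_var (split_shape c s0 qs Zs sl) v ->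
      ~ shape_var (split_shape c s0 qs Zs sl') v.
    move=> e ne /inv[[i [_ _ ->]]|[i [_ nz ->]]|[]]; last by rewrite e eqxx.
      by move=> /inv[[j [e2]]|[j [e2]]|[_ _ /nt_var_inj[]]] //; rewrite e2 eqxx in ne.
    move=> /inv[[j [e2]]|[j [e2]]|[_ cn /nt_var_inj[_ e2 _]]]; try by rewrite e2 eqxx in ne.
    by case: (ok.2 i nz); rewrite e2 => e3; [rewrite e3 in cn|rewrite e3 eqxx in ne].
  move=> sl sl' v h h'; case: (sl =P s0) => [e|/eqP ne]; case: (sl' =P s0) => [e'|/eqP ne'].
  + by rewrite e e'.
  + by case: (key _ _ _ e ne' h).
  + by case: (key _ _ _ e' ne h').
  + case/inv: h => [[? [e]]|[? [e]]|[_ _]]; [by rewrite e eqxx in ne|by rewrite e eqxx in ne|].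
    by case/inv: h' => [[? [e]]|[? [e]]|[_ _ ->]]; [rewrite e eqxx in ne'|rewrite e eqxx in ne'|move=> /nt_var_inj[]].
- move=> i k sl sl' /inv[[j [-> z /nt_var_inj[-> -> _]]]|[j [-> z /nt_var_inj[-> -> _]]]|[ne cs /nt_var_inj[-> -> _]]].
  + by split; rewrite /= ?eqxx ?cs0.
  + by split; rewrite /= ?cs0 //; rewrite c'new.
  + by split; rewrite /= ?c'old // cs.
- have N sl0 : c' sl0 != None -> forall sl2, relevant_slot (NTconf c') sl2 ->
      exists sl3, shape_var (split_shape c s0 qs Zs sl3) (nt_var (NTconf c') sl2 0).
    move=> c'0 sl2; rewrite (relevant_NTconf c'0); case e: (c' sl2) => [q2|] // _.
    case: (split_config_inv e) => [[i [-> z _]]|[ne cs]].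
      by exists s0; rewrite /split_shape eqxx; exists i; rewrite ffunE /place (negPf z).
    by exists sl2; rewrite /split_shape (negPf ne) cs.
  move=> i k sl sl' h sl2.
  case: (inv _ _ h) => [[j [e z /nt_var_inj[ei e' _]]]|[j [_ z /nt_var_inj[-> _ ->]]]|[ne cs /nt_var_inj[-> _ ->]]].
  + by rewrite ei => /= /eqP->; exists sl; rewrite -ei -e'.
  + by apply: (N (s0.1, Zs j)); rewrite c'new.
  + by apply: (N sl); rewrite c'old.
Qed.

Lemma production_words_ok i t : production_words i t ->
  [/\ numbered t, complete relevant t, clean relevant t & typed relevant i t].
Proof.
move=> [g pg <-]; have [h1 h2 h3 h4] : wellformed i g.
  case: i pg => [[[[b q]|]|]|c] /=.
  - by move=> [[f [qs [_ ->]]]|[_ ->]]; [exact: run_wellformed|exact: junk_wellformed].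
  - by move=> [f ->]; exact: any_wellformed.
  - by move=> [[f ->]|[q1 [q2 [Z [_ ->]]]]]; [exact: cong_wellformed|exact: start_wellformed].
  - move=> [[s0 [q [f [qs [Zs [e _ ok ->]]]]]]|[ok ->]]; last exact: link_wellformed.
    exact: split_wellformed e ok.
split.
- exact: word_numbered.
- exact: word_complete.
- by apply: word_clean => i' k sl sl' /h3[].
- apply: word_typed => [i' k sl sl' /h3[]//|sl v].
  by have [i' [sl' [k ->]]] := nt_varP v => /h3[].
Qed.

(** * Soundness of the grammar *)

Local Notation generated := (Gen production_words predT (fun=> classical_sets.set0)).

Definition slot_value (w : m.-tuple (T void)) (sl : Sl) : T void := tnth w (enum_rank sl).

Lemma slot_value_evaluate a g sl : slot_value (evaluate a (word_of_shapes g)) sl = shape_value (assign a) (g sl).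
Proof. by rewrite /slot_value /word_of_shapes !tnth_mktuple enum_rankK shape_valueE. Qed.

(** For a configuration, one family [s] of linked pairs serves all the slots of both sides; this is
    what ties the two sides together. *)
Definition meaning (i : I) (w : Sl -> T void) : Prop :=
  match i with
  | inl None => linked (w (root_slot true)) (w (root_slot false))
  | inl (Some None) => True
  | inl (Some (Some (b, q))) => exists u, [/\ runs b u q,
      forall x, occ (Some x) u = 0 & forall s, matches s u (w (root_slot true))]
  | inr c => exists s : bool -> X -> T void,
      (forall x, linked (s true x) (s false x)) /\
      forall sl q, c sl = Some q -> exists u, [/\ runs sl.1 u q,
        forall x, occ (Some x) u = (x \in sl.2) & matches (s sl.1) u (w sl)]
  end.

Lemma meaning_empty c w : (forall sl, c sl = None) -> meaning (NTconf c) w.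
Proof.
by move=> h; exists (fun _ _ => a0); split=> [x|sl q]; [exact: linked_refl|rewrite h].
Qed.

Lemma place_meaning al c b q Z k s :
  (Z = emptyset -> meaning (NTrun (Some (b, q))) (fun sl => al (nt_var (NTrun (Some (b, q))) sl k))) ->
  (Z != emptyset -> exists u, [/\ runs b u q, forall x, occ (Some x) u = (x \in Z) &
     matches s u (al (nt_var (NTconf c) (b, Z) 0))]) ->
  exists u, [/\ runs b u q, forall x, occ (Some x) u = (x \in Z) &
     matches s u (al (place c b q Z k))].
Proof.
rewrite /place; case: (Z =P emptyset) => [-> /(_ erefl)|_ _ /(_ isT) //].
move=> [u [h1 h2 h3]] _; exists u; split=> // x; by rewrite h2 inE.
Qed.

Lemma gen_sound i w : generated i w -> meaning i (slot_value w).
Proof.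
elim=> {i w} i t a [g pg <-] _ IH _.
have {}IH j k sl sl' : shape_var (g sl') (nt_var j sl k) -> meaning j (slot_value (a j k)).
  by move=> h; apply: IH => //; exists (enum_rank sl); apply/occ_word; exists sl'.
have assignE j sl k : assign a (nt_var j sl k) = slot_value (a j k) sl by [].
case: i pg => [[[[b q]|]|]|c] /=; rewrite ?slot_value_evaluate //.
- move=> [[f [qs [hat eg]]]|[hvt eg]]; rewrite eg /= in IH *.
    have : forall i, exists u, [/\ runs b u (qs i), forall x, occ (Some x) u = 0 &
        forall s, matches s u (slot_value (a (NTrun (Some (b, qs i))) i) (root_slot true))].
      move=> i; apply: (IH (NTrun (Some (b, qs i))) i (root_slot true) (root_slot true)).
      by rewrite /run_shape eqxx; exists i; rewrite ffunE.
    move=> /choice[u hu]; exists (App f (finfun u)); rewrite /run_shape eqxx; split.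
    + by apply/run_appE; exists qs => // i; rewrite ffunE; case: (hu i).
    + by move=> x; rewrite occ_App big1 // => i _; rewrite ffunE; case: (hu i).
    + move=> s /=; eexists; first reflexivity.
      by move=> i; rewrite !ffunE assignE; case: (hu i).
  exists (Var None); split=> //; exact/run_varE.
- move=> [[f eg]|[q1 [q2 [Z [w eg]]]]]; rewrite eg in IH *.
    rewrite /cong_shape eqxx /=; apply: linked_cong => i; rewrite !ffunE !assignE.
    apply: (IH NTlink i (root_slot true) (root_slot true)).
    by rewrite /cong_shape eqxx /=; exists i; rewrite ffunE.
  set c := start_config q1 q2 Z.
  have cE b : Z != emptyset -> c (b, Z) = Some (if b then q1 else q2).
    by move=> nz; rewrite ffunE eqxx nz.
  have [s [hs hc]] : meaning (NTconf c) (slot_value (a (NTconf c) 0)).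
    case: (boolP (Z == emptyset)) => [/eqP z|nz].
      by apply: meaning_empty => sl; rewrite ffunE z eqxx andbF.
    apply: (IH _ _ (true, Z) (root_slot true)).
    by rewrite /start_shape eqxx /= /place (negPf nz).
  have H b : exists u, [/\ runs b u (if b then q1 else q2), forall x, occ (Some x) u = (x \in Z) &
      matches (s b) u (shape_value (assign a) (start_shape q1 q2 Z (root_slot b)))].
    rewrite /start_shape eqxx /=; apply: place_meaning => [z|nz].
      apply: (IH (NTrun (Some (b, if b then q1 else q2))) 0 (root_slot true) (root_slot b)).
      by rewrite /start_shape eqxx /= /place z eqxx.
    by apply: (hc (b, Z)); exact: cE.
  have [u [h1 h2 h3]] := H true; have [v [h4 h5 h6]] := H false.
  apply: (linked_rule w h1 h4 _ _ h3 h6) => // x; first by rewrite h2 h5.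
  by rewrite h5; case: (_ \in _).
- move=> [[s0 [q [f [qs [Zs [cs0 hat ok eg]]]]]]|[[[sl0 c0] h1 h2] eg]].
    rewrite eg in IH *; set c' := split_config c s0 qs Zs.
    have [s [hs hc]] : meaning (NTconf c') (slot_value (a (NTconf c') 0)).
      (* If the split leaves nothing pending, no instance of [c'] occurs in the word and dummy
         substitutions do. *)
      case: (EM (exists sl, c' sl != None)) => [[sl]|no]; last first.
        apply: meaning_empty => sl; case e: (c' sl) => [q'|] //.
        by case: no; exists sl; rewrite e.
      case e: (c' sl) => [q'|] // _; case: (split_config_inv e) => [[i [el nz _]]|[ne cs]].
        apply: (IH _ _ sl s0); rewrite /split_shape eqxx; exists i.
        by rewrite ffunE /place (negPf nz) el.
      by apply: (IH _ _ sl sl); rewrite /split_shape (negPf ne) cs.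
    exists s; split=> // sl q'; rewrite slot_value_evaluate /split_shape; case: eqP => [->|/eqP ne] cs.
      have -> : q' = q by move: cs; rewrite cs0 => -[].
      have : forall i, exists u, [/\ runs s0.1 u (qs i), forall x, occ (Some x) u = (x \in Zs i) &
           matches (s s0.1) u (assign a (place c' s0.1 (qs i) (Zs i) i))].
        move=> i; apply: place_meaning => [z|nz].
          apply: (IH (NTrun (Some (s0.1, qs i))) i (root_slot true) s0).
          by rewrite /split_shape eqxx; exists i; rewrite ffunE /place z eqxx.
        by apply: (hc (s0.1, Zs i)); exact: split_config_new.
      move=> /choice[u hu]; exists (App f (finfun u)); split.
      + by apply/run_appE; exists qs => // i; rewrite ffunE; case: (hu i).
      + move=> x; rewrite occ_App -ok.1; apply: eq_bigr => i _; rewrite ffunE.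
        by case: (hu i).
      + rewrite /=; eexists; first reflexivity.
        by move=> i; rewrite !ffunE; case: (hu i).
    rewrite cs /= assignE; apply: hc; rewrite -cs; apply: split_config_old => //.
    by rewrite cs.
  rewrite eg in IH *.
  have E sl q : c sl = Some q -> exists x, [/\ link_shape c sl = Leaf (nt_var NTlink (root_slot sl.1) (enum_rank x)),
      sl.2 = [set x]%SET & vt sl.1 (Some x) q].
    move=> e; rewrite /link_shape e; have [x ex hx] := h1 _ _ e; exists x; split=> //.
    case: pickP => [y /eqP|/(_ x)]; last by rewrite ex eqxx.
    by rewrite ex => /set1_inj->.
  (* The pair for a pending [x] is read in the instance [enum_rank x]; any other variable gets [a0],
     linked to itself. *)
  exists (fun b x => if (c (true, [set x]%SET) != None) then slot_value (a NTlink (enum_rank x)) (root_slot b) else a0).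
  split.
    move=> x; case: ifP => cx; last exact: linked_refl.
    case e: (c (true, [set x]%SET)) cx => [q|] // _.
    apply: (IH NTlink _ (root_slot true) (true, [set x]%SET)).
    by have [y [-> /= /set1_inj-> _]] := E _ _ e.
  move=> sl q e; have [x [ge ex hx]] := E _ _ e; exists (Var (Some x)); split.
  + exact/run_varE.
  + by move=> y; rewrite ex inE /=.
  + rewrite slot_value_evaluate ge /= assignE (_ : c (true, [set x]%SET) != None) //.
    have := h2 x; case: sl ge ex hx e => -[] Z /= _ -> _ -> //.
Qed.

(** * Completeness of the grammar *)

Definition slot_tuple (w : Sl -> T void) : m.-tuple (T void) := [tuple w (enum_val j) | j < m].

Definition slot_assign (al : I -> nat -> Sl -> T void) (v : V) : T void :=
  al v.1.1 v.2 (enum_val v.1.2).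

Lemma slot_assignE al i sl k : slot_assign al (nt_var i sl k) = al i k sl.
Proof. by rewrite /slot_assign /nt_var /= enum_rankK. Qed.

Lemma gen_intro i g al w : production i g ->
  (forall j k sl sl', shape_var (g sl') (nt_var j sl k) -> generated j (slot_tuple (al j k))) ->
  (forall sl, w sl = shape_value (slot_assign al) (g sl)) ->
  generated i (slot_tuple w).
Proof.
move=> pg hal hw; pose a j k := slot_tuple (al j k).
have -> : slot_tuple w = evaluate a (word_of_shapes g).
  apply: eq_from_tnth => j; rewrite !tnth_mktuple shape_valueE hw.
  case: (g _) => [|v|f h] //=; last (congr App; apply/ffunP => i0; rewrite !ffunE);
  by rewrite /assign /a /slot_tuple tnth_mktuple.
apply: Gen_intro => [|j k [l /occ_word[sl' h]] _|j k] //; first by exists g.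
by apply: (hal _ _ (enum_val l) sl'); rewrite /nt_var enum_valK.
Qed.

Definition on_nat A n (d : A) (a : 'I_n -> A) (k : nat) : A :=
  if insub k is Some i then a i else d.

Lemma on_natE A n (d : A) (a : 'I_n -> A) i : on_nat d a (nat_of_ord i) = a i.
Proof. by rewrite /on_nat (valK i). Qed.

Definition on_root (t : T void) (sl : Sl) : T void := if sl == root_slot true then t else a0.
Definition on_roots (t1 t2 : T void) (sl : Sl) : T void :=
  if sl.2 == emptyset then (if sl.1 then t1 else t2) else a0.

Lemma gen_any t : generated (NTrun None) (slot_tuple (on_root t)).
Proof.
elim/term_rec_ffun: t => // f a IH.
apply: (gen_intro (g := any_shape f) (al := fun _ k => on_root (on_nat a0 a k))).
- by exists f.
- move=> j k sl sl'; rewrite /any_shape; case: eqP => // _ [i].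
  by rewrite ffunE => /nt_var_inj[<- _ <-]; rewrite on_natE; exact: IH.
- move=> sl; rewrite /on_root /any_shape; case: eqP => // _ /=.
  by congr App; apply/ffunP => i; rewrite !ffunE slot_assignE eqxx on_natE.
Qed.

Lemma gen_run b q u s t : runs b u q -> (forall x, occ (Some x) u = 0) -> matches s u t ->
  generated (NTrun (Some (b, q))) (slot_tuple (on_root t)).
Proof.
elim/term_rec_ffun: u q t => [[x|]|f a IH] q t.
- by move=> _ /(_ x) /=; rewrite eqxx.
- move=> /run_varE hv _ _.
  apply: (gen_intro (g := junk_shape) (al := fun _ _ => on_root t)).
  + by right.
  + move=> j k sl sl'; rewrite /junk_shape; case: eqP => // _ /nt_var_inj[<- _ _].
    exact: gen_any.
  + by move=> sl; rewrite /on_root /junk_shape; case: eqP => //= _; rewrite slot_assignE eqxx.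
move=> /run_appE[qs hr hat] h0 [bb -> hb].
apply: (gen_intro (g := run_shape b qs) (al := fun _ k => on_root (on_nat a0 bb k))).
- by left; exists f, qs.
- move=> j k sl sl'; rewrite /run_shape; case: eqP => // _ [i].
  rewrite ffunE => /nt_var_inj[<- _ <-]; rewrite on_natE.
  apply: (IH i (qs i) (bb i) (hr i) _ (hb i)) => x; apply/eqP; rewrite -leqn0 leqNgt; apply/negP => h.
  by have := occ_arg_gt0 h; rewrite h0.
- move=> sl; rewrite /on_root /run_shape; case: eqP => // _ /=.
  by congr App; apply/ffunP => i; rewrite !ffunE slot_assignE eqxx on_natE.
Qed.

(** Variables weigh nothing, so a split lowers the total weight by the one symbol that it reads. *)
Fixpoint tsize (u : T (option X)) : nat :=
  if u is App f a then (\sum_i tsize (a i)).+1 else 0.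

(** Invariant of the configurations met while reading [u] and [v]. The last clause, that both sides
    cover the same variables, makes the singletons correspond once only variables are pending. *)
Definition valid c : Prop :=
  [/\ exists sl, c sl != None,
      forall sl, c sl != None -> sl.2 != emptyset,
      forall b Z Z' x, c (b, Z) != None -> c (b, Z') != None -> x \in Z -> x \in Z' -> Z = Z' &
      forall b x, (exists2 Z, c (b, Z) != None & x \in Z) ->
        exists2 Z, c (~~ b, Z) != None & x \in Z].

Lemma split_config_cover c s0 f (qs : {ffun 'I_(ar f) -> Q}) Zs b x :
  split_ok c s0 Zs -> c s0 != None ->
  (exists2 Z, split_config c s0 qs Zs (b, Z) != None & x \in Z) <->
  (exists2 Z, c (b, Z) != None & x \in Z).
Proof.
move=> ok cs0; split=> -[Z].
  case e: (split_config _ _ _ _ _) => [q|] // _ xZ.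
  case: (split_config_inv e) => [[i [[eb eZ] nz _]]|[ne cs]]; last by exists Z; rewrite ?cs.
  exists s0.2; first by rewrite eb; case: (s0) cs0.
  have := ok.1 x; rewrite (bigD1 i) //= -eZ xZ; by case: (x \in s0.2).
move=> cs xZ; case: (altP ((b, Z) =P s0)) => [e|ne]; last first.
  by exists Z => //; rewrite (split_config_old _ ok ne).
have := ok.1 x; rewrite -e /= xZ => h.
have /existsP[i xi] : [exists i, x \in Zs i].
  apply: contraT; rewrite negb_exists => /forallP h'; move: h.
  by rewrite big1 // => i _; rewrite (negPf (h' i)).
exists (Zs i) => //; have nz : Zs i != emptyset by apply/set0Pn; exists x.
by have := split_config_new qs ok nz; rewrite -e /= => ->.
Qed.

(** A pending [None] would have an empty set of variables, so every pending set is a singleton, and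
    the covering clause of [valid] pairs the two sides. *)
Lemma gen_config_leaves c us w (s : bool -> X -> T void) : valid c ->
  (forall sl q, c sl = Some q -> [/\ runs sl.1 (us sl) q,
     forall x, occ (Some x) (us sl) = (x \in sl.2) & matches (s sl.1) (us sl) (w sl)]) ->
  (forall sl, c sl = None -> w sl = a0) ->
  (forall x, generated NTlink (slot_tuple (on_roots (s true x) (s false x)))) ->
  (forall sl q, c sl = Some q -> is_var (us sl)) -> generated (NTconf c) (slot_tuple w).
Proof.
move=> [V0 V1 V2 V3] hu hw hD hV.
have U sl q : c sl = Some q -> exists x, [/\ sl.2 = [set x]%SET, vt sl.1 (Some x) q &
    w sl = s sl.1 x].
  move=> e; have := hV _ _ e; have := V1 sl; rewrite e => /(_ isT).
  have [] := hu _ _ e; case: (us sl) => // -[x|] h1 h2 h3 nz _.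
    exists x; split=> //; last by move/run_varE: h1.
    by apply/setP => y; have := h2 y; rewrite inE /= -[Some y == Some x]/(y == x); case: (y == x); case: (y \in sl.2).
  case/set0Pn: nz => x xs; have := h2 x; by rewrite xs.
have E sl q : c sl = Some q -> exists x, [/\ sl.2 = [set x]%SET, w sl = s sl.1 x &
    link_shape c sl = Leaf (nt_var NTlink (root_slot sl.1) (enum_rank x))].
  move=> e; have [x [ex hx hwx]] := U _ _ e; exists x; split=> //.
  rewrite /link_shape e; case: pickP => [y /eqP|/(_ x)]; last by rewrite ex eqxx.
  by rewrite ex => /set1_inj->.
have sng b x : c (b, [set x]%SET) != None -> c (~~ b, [set x]%SET) != None.
  move=> h; have [|Z] := V3 b x; first by exists [set x]%SET => //; rewrite inE.
  case e: (c (~~ b, Z)) => [q|] // _; have [y [/= eZ _ _]] := U _ _ e.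
  by rewrite eZ inE => /eqP ->; rewrite -eZ e.
have endok : link_ok c.
  split=> // [sl q e|x]; first by have [x []] := U _ _ e; exists x.
  by apply/idP/idP; [exact: (sng true)|exact: (sng false)].
apply: (gen_intro (g := link_shape c) (al := fun _ =>
   on_nat (fun=> a0) (fun r : 'I_#|X| => on_roots (s true (enum_val r)) (s false (enum_val r))))).
- by right.
- move=> j k sl sl'; case e: (c sl') => [q|]; last by rewrite /link_shape e.
  have [x [_ _ ->]] := E _ _ e => /nt_var_inj[<- _ <-].
  by rewrite on_natE enum_rankK; exact: hD.
- move=> sl; case e: (c sl) => [q|]; last by rewrite (hw _ e) /link_shape e.
  have [x [_ -> ->]] := E _ _ e; rewrite /= slot_assignE on_natE /on_roots /= eqxx enum_rankK.
  by case: (sl.1).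
Qed.

(** Induction on the number of symbols in the patterns: any slot whose pattern starts with a symbol
    may be split, in any order. *)
Lemma gen_config n c us w (s : bool -> X -> T void) : valid c ->
  (forall sl q, c sl = Some q -> [/\ runs sl.1 (us sl) q,
     forall x, occ (Some x) (us sl) = (x \in sl.2) & matches (s sl.1) (us sl) (w sl)]) ->
  (forall sl, c sl = None -> w sl = a0) ->
  (forall x, generated NTlink (slot_tuple (on_roots (s true x) (s false x)))) ->
  \sum_sl tsize (us sl) <= n -> generated (NTconf c) (slot_tuple w).
Proof.
elim: n c us w => [|n IH] c us w [V0 V1 V2 V3] hu hw hD hn;
  (case: (EM (exists sl f (a : {ffun 'I_(ar f) -> T (option X)}),
    c sl != None /\ us sl = App f a)) => [[s0 [f [a [cs0 ea]]]]|noApp]; last first).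
- apply: (gen_config_leaves (us := us) (s := s)) => // sl q e.
  by case eu: (us sl) => [//|f a]; case: noApp; exists sl, f, a; rewrite e.
- move: hn; rewrite (bigD1 s0) //= ea; by [].
- apply: (gen_config_leaves (us := us) (s := s)) => // sl q e.
  by case eu: (us sl) => [//|f a]; case: noApp; exists sl, f, a; rewrite e.
case es0: (c s0) cs0 => [q0|] // _.
have [hr0 ho0 hi0] := hu _ _ es0.
move: hr0 ho0 hi0; rewrite ea => /run_appE[qs hqs hat] ho0 [bb ewb hbb].
pose Zs := [ffun i => [set x | 0 < occ (Some x) (a i)]%SET].
have occZ i x : occ (Some x) (a i) = (x \in Zs i).
  rewrite !ffunE inE; have := ho0 x; rewrite occ_App (bigD1 i) //=.
  by case: (occ _ _) => [|[|k]] //=; case: (_ \in _).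
clearbody Zs.
have ZsSub i x : x \in Zs i -> x \in s0.2.
  move=> xi; have := ho0 x; rewrite occ_App (bigD1 i) //= occZ xi.
  by case: (x \in _).
have ok : split_ok c s0 Zs.
  split.
    by move=> x; rewrite -ho0 occ_App; apply: eq_bigr => i _; rewrite occZ.
  move=> i /set0Pn[x xi]; case e: (c (s0.1, Zs i)) => [q|]; last by left.
  right; rewrite (V2 s0.1 (Zs i) s0.2 x) //; first by case: (s0).
  - by rewrite e.
  - by case: (s0) es0 => b Z /= ->.
  - exact: ZsSub xi.
set c' := split_config c s0 qs Zs.
pose us' := split_slot s0 Zs a (Var None) us.
pose w' := split_slot s0 Zs bb a0 w.
have cov b x := @split_config_cover c s0 f qs Zs b x ok.
have gw' : (exists sl, c' sl != None) -> generated (NTconf c') (slot_tuple w').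
  move=> nz'; apply: (IH c' us' w' _ _ _ hD).
  - split=> //.
    + move=> sl; case e: (c' sl) => [q|] // _.
      by case: (split_config_inv e) => [[i [-> nz _]]|[_ cs]] //; apply: V1; rewrite cs.
    + move=> b Z Z' x.
      have P1 Z1 : c' (b, Z1) != None -> x \in Z1 ->
          (exists i, [/\ b = s0.1, Z1 = Zs i & x \in Zs i]) \/
          [/\ (b, Z1) != s0, c (b, Z1) != None & x \in Z1].
        case e: (c' _) => [q|] // _ xZ1.
        case: (split_config_inv e) => [[i [[eb eZ] nz _]]|[ne cs]].
          by left; exists i; rewrite -eZ.
        by right; rewrite cs.
      have P2 Z1 i : b = s0.1 -> x \in Zs i -> (b, Z1) != s0 -> c (b, Z1) != None ->
          x \in Z1 -> False.
        move=> eb xi ne cZ xZ; case/eqP: ne; rewrite (V2 b Z1 s0.2 x) //.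
        - by rewrite eb; case: (s0).
        - by rewrite eb; case: (s0) es0 => b1 Z2 /= ->.
        - exact: ZsSub xi.
      move=> h1 h2 x1 x2; case: (P1 _ h1 x1) (P1 _ h2 x2) => [[i [eb -> xi]]|[ne cZ _]].
        case=> [[j [_ -> xj]]|[ne cZ _]]; first by rewrite (split_disjoint ok xi xj).
        by case: (P2 _ _ eb xi ne cZ).
      case=> [[j [eb _ xj]]|[ne' cZ' _]]; first by case: (P2 _ _ eb xj ne cZ).
      exact: V2 cZ cZ' x1 x2.
    + move=> b x; rewrite !cov ?es0 //; exact: V3.
  - move=> sl q e; case: (split_config_inv e) => [[i [-> nz ->]]|[ne cs]].
      rewrite /us' /w' !(split_new _ _ _ ok nz) /=.
      by split=> [|x|]; [exact: hqs|rewrite occZ|exact: hbb].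
    by rewrite /us' /w' !(split_old _ _ _ ok) ?cs //; exact: hu.
  - move=> sl; rewrite /c' /w' ffunE /split_slot; case: pickP => // _.
    by case: eqP => // _; exact: hw.
  (* The new pattern of a slot is either an argument of the split term or an old pattern; [E] adds
     up all the possible origins, and exchanging the sums counts each of them once, without the
     symbol just read. *)
  - pose E sl := \sum_i (sl == (s0.1, Zs i)) * tsize (a i) + (sl != s0) * tsize (us sl).
    have bound sl : tsize (us' sl) <= E sl.
      rewrite /E /us' /split_slot; case: pickP => [i /andP[e _]|_].
        by rewrite (bigD1 i) //= e mul1n -addnA leq_addr.
      by case: eqP => //= _; rewrite mul1n leq_addl.
    apply: (@leq_trans (\sum_sl E sl)); first by apply: leq_sum => sl _; exact: bound.
    rewrite /E big_split /= exchange_big /= -ltnS; apply: leq_trans hn.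
    rewrite [X in _ < X](bigD1 s0) //= ea /= addSn ltnS.
    apply: leq_add.
      apply: leq_sum => i _; rewrite (bigD1 (s0.1, Zs i)) //= eqxx mul1n big1 ?addn0 //.
      by move=> sl /negPf->.
    by rewrite [X in _ <= X]big_mkcond; apply: leq_sum => sl _;
      case: eqP; rewrite ?mul1n.
apply: (gen_intro (g := split_shape c s0 qs Zs) (al := fun j k =>
   if j is inr _ then w' else on_root (on_nat a0 bb k))).
- by left; exists s0, q0, f, qs, Zs.
- move=> j k sl sl'; rewrite /split_shape; case: eqP => [_|/eqP ne].
    move=> [i]; rewrite ffunE /place; case: ifP => [/eqP z|/negbT z] /nt_var_inj[<- _ <-].
      rewrite on_natE; apply: (gen_run (hqs i) _ (hbb i)) => x.
      by rewrite occZ z inE.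
    by apply: gw'; exists (s0.1, Zs i); rewrite (split_config_new _ ok z).
  case cs: (c sl') => [q|] //= /nt_var_inj[<- _ _]; apply: gw'.
  by exists sl'; rewrite (split_config_old _ ok ne) cs.
- move=> sl; rewrite /split_shape; case: eqP => [->|/eqP ne].
    rewrite ewb /=; congr App; apply/ffunP => i; rewrite !ffunE /place.
    case: ifP => [_|/negbT z]; rewrite slot_assignE; first by rewrite /= /on_root eqxx on_natE.
    by rewrite /= /w' (split_new _ _ _ ok z).
  case cs: (c sl) => [q|] /=; last exact: hw.
  by rewrite slot_assignE /= /w' (split_old _ _ _ ok ne) ?cs.
Qed.

Lemma gen_linked t1 t2 : linked t1 t2 -> generated NTlink (slot_tuple (on_roots t1 t2)).
Proof.
elim=> {t1 t2} [f a b _ IH|q1 q2 u v s1 s2 t1 t2 w hu hv uv lin i1 i2 _ IH].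
  apply: (gen_intro (g := cong_shape f) (al := fun _ k => on_roots (on_nat a0 a k) (on_nat a0 b k))).
  - by left; exists f.
  - move=> j k sl sl'; rewrite /cong_shape; case: eqP => // _ [i].
    by rewrite ffunE => /nt_var_inj[<- _ <-]; rewrite !on_natE.
  - move=> sl; rewrite /on_roots /cong_shape; case: eqP => // e /=.
    by case eb: sl.1; congr App; apply/ffunP => i; rewrite !ffunE slot_assignE !on_natE /on_roots e eqxx eb.
pose Z := [set x | 0 < occ (Some x) v]%SET.
have occv x : occ (Some x) v = (x \in Z).
  by rewrite inE; have := lin x; case: (occ _ _) => [|[|]].
clearbody Z.
have run_b b : runs b (if b then u else v) (if b then q1 else q2) by case: b.
have occ_b b x : occ (Some x) (if b then u else v) = (x \in Z) by case: b; rewrite ?uv occv.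
have inst_b b : matches (if b then s1 else s2) (if b then u else v) (if b then t1 else t2) by case: b.
set c := start_config q1 q2 Z.
pose wc sl := if c sl is Some _ then (if sl.1 then t1 else t2) else a0.
apply: (gen_intro (g := start_shape q1 q2 Z) (al := fun j _ =>
  match j with
  | inl (Some (Some (b, _))) => on_root (if b then t1 else t2)
  | _ => wc
  end)).
- by right; exists q1, q2, Z.
- move=> j k sl sl'; rewrite /start_shape; case: eqP => //= _.
  rewrite /place; case: ifP => [/eqP z|/negbT z] /nt_var_inj[<- _ _].
    apply: (gen_run (run_b sl'.1) _ (inst_b sl'.1)) => x.
    by rewrite occ_b z inE.
  apply: (gen_config (us := fun sl => if sl.1 then u else v)
    (s := fun b => if b then s1 else s2)); last exact: leqnn.
  + split.
    * by exists (true, Z); rewrite ffunE /= eqxx z.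
    * by move=> sl0; rewrite ffunE; case: (sl0.2 =P Z) => /= [->|//]; rewrite z.
    * move=> b Z1 Z2 x; rewrite !ffunE /=.
      by case: (Z1 =P Z) => /= [->|//]; case: (Z2 =P Z) => /= [->|//].
    * move=> b x [Z1 h xZ]; exists Z1 => //; move: h; rewrite !ffunE /=.
      by case: ifP.
  + move=> sl0 q; rewrite ffunE; case: ifP => // /andP[/eqP e _] [<-].
    split=> [|x|]; [exact: run_b|by rewrite occ_b e|].
    by rewrite /wc ffunE e eqxx z; exact: inst_b.
  + by move=> sl0; rewrite /wc => ->.
  + exact: IH.
- move=> sl; rewrite /on_roots /start_shape; case: eqP => [e|//].
  have evL al' v' : shape_value al' (Leaf v') = al' v' by [].
  rewrite evL /place; case z: (Z == emptyset); rewrite slot_assignE /=.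
    by rewrite /on_root eqxx.
  by rewrite /wc ffunE /= eqxx z.
Qed.

Theorem Rat_linked : Rat (pair_lang (I * 'I_m)%type linked).
Proof.
pose t0 : tword ar (I * 'I_m)%type 2 := [tuple Var (nt_var NTlink (root_slot true) 0); Var (nt_var NTlink (root_slot false) 0)].
have t0E (v : V) : 0 < occw v t0 <-> exists b, v = nt_var NTlink (root_slot b) 0.
  rewrite /occw !big_ord_recl big_ord0 addn0 /=; split.
    case: eqP => [-> _|_]; first by exists true.
    by case: eqP => // -> _; exists false.
  by move=> [[] ->]; rewrite eqxx // addnC.
have nt0 : numbered t0.
  move=> v; rewrite /occw !big_ord_recl big_ord0 addn0 /=.
  by case: eqP => [->|_]; case: eqP => // /nt_var_inj[].
have it0 i k : has_inst i k t0 -> i = NTlink /\ k = 0.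
  by move=> [j /t0E[b]]; rewrite /nt_var => -[-> _ ->].
have ct0 : complete relevant t0.
  move=> i k j /it0[-> ->]; rewrite /relevant relevant_NTlink => /root_slot_eta e; apply/t0E.
  by exists (enum_val j).1; rewrite -e /nt_var enum_valK.
have := Rat_Gen relevant_ex production_words_finite (fun i t h => let: And4 h1 _ _ _ := production_words_ok h in h1)
   (fun i t h => let: And4 _ h2 h3 h4 := production_words_ok h in And3 h2 h3 h4) a0 nt0 ct0
   (fun i k h => (it0 i k h).1).
rewrite (_ : [set _ | w in _] = pair_lang (I * 'I_m)%type linked) //.
have evaluateE a : evaluate a t0 = [tuple slot_value (a NTlink 0) (root_slot true); slot_value (a NTlink 0) (root_slot false)].
  by apply: eq_from_tnth => -[[|[|j]] hj] //; rewrite /evaluate tnth_mktuple.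
have ofE (t1 t2 : T void) : [tuple of_ground V (tnth [tuple t1; t2] j) | j < 2] =
    [tuple of_ground V t1; of_ground V t2].
  by apply: eq_from_tnth => -[[|[|j]] hj] //; rewrite tnth_mktuple.
apply/seteqP; split=> w.
  move=> [_ [a ha <-] <-]; rewrite evaluateE ofE.
  eexists; eexists; split; last reflexivity.
  apply: (gen_sound (i := NTlink)); apply: ha.
  by exists (enum_rank (root_slot true)); apply/t0E; exists true.
move=> [t1 [t2 [h ->]]].
exists [tuple t1; t2]; last exact: ofE.
exists (fun _ _ => slot_tuple (on_roots t1 t2)); first by move=> k _; exact: gen_linked.
by rewrite evaluateE /slot_value /slot_tuple !tnth_mktuple !enum_rankK /on_roots /= !eqxx.
Qed.
End Linked.

(** * Positions *)

Section Positions.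
Variables (F : finType) (ar : F -> nat).
Local Notation T := (term ar).

(** Positions are lists of natural numbers, not of ordinals, so that one position can be followed in
    different terms. *)
Fixpoint subterm_at V (p : seq nat) (t : T V) : option (T V) :=
  match p, t with
  | [::], _ => Some t
  | i :: p', App f a => if insub i is Some j then subterm_at p' (a j) else None
  | _ :: _, Var _ => None
  end.

Fixpoint replace_at V (p : seq nat) (t u : T V) : T V :=
  match p, t with
  | [::], _ => u
  | i :: p', App f a =>
      if insub i is Some j then App f (setarg a j (replace_at p' (a j) u)) else t
  | _ :: _, Var _ => t
  end.

Lemma subterm_consP V i p (t s : T V) : subterm_at (i :: p) t = Some s ->
  exists f (a : {ffun 'I_(ar f) -> T V}) j,
    [/\ t = App f a, i = val j & subterm_at p (a j) = Some s].
Proof.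
case: t => //= f a; case: insubP => // j _ e h; by exists f, a, j.
Qed.

Lemma subterm_App V f (a : {ffun 'I_(ar f) -> T V}) j p :
  subterm_at (nat_of_ord j :: p) (App f a) = subterm_at p (a j).
Proof. by rewrite /= (valK j). Qed.

Lemma replace_App V f (a : {ffun 'I_(ar f) -> T V}) j p u :
  replace_at (nat_of_ord j :: p) (App f a) u = App f (setarg a j (replace_at p (a j) u)).
Proof. by rewrite /= (valK j). Qed.

Lemma subterm_cat V p q (t : T V) : subterm_at (p ++ q) t = obind (subterm_at q) (subterm_at p t).
Proof.
elim: p t => [|i p IH] [v|f a] //=.
by case: insubP => // j _ _; exact: IH.
Qed.

Lemma subterm_subst V W (s : V -> T W) p t u :
  subterm_at p t = Some u -> subterm_at p (subst s t) = Some (subst s u).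
Proof.
elim: p t => [|i p IH] t; first by case: t => [v|f a] [<-].
by move=> /subterm_consP[f [a [j [-> -> /IH h]]]]; rewrite subterm_App ffunE.
Qed.

(** This dichotomy separates the overlaps with [t] from what happens inside the substitution. *)
Lemma subterm_subst_inv V W (s : V -> T W) p t u : subterm_at p (subst s t) = Some u ->
  (exists t', [/\ subterm_at p t = Some t', ~~ is_var t' & u = subst s t']) \/
  (exists p1 p2 x, [/\ p = p1 ++ p2, subterm_at p1 t = Some (Var x) & subterm_at p2 (s x) = Some u]).
Proof.
elim: p t => [|i p IH] [v|f a].
- by move=> h; right; exists [::], [::], v.
- by move=> [<-]; left; exists (App f a).
- by move=> h; right; exists [::], (i :: p), v.
move=> /=; case: insubP => // j _ <-; rewrite ffunE => /IH[[t' h]|[p1 [p2 [x [-> h1 h2]]]]].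
  by left; exists t'.
by right; exists (val j :: p1), p2, x; split=> //=; rewrite (valK j).
Qed.

Lemma replace_subterm V p (t u : T V) : subterm_at p t = Some u -> replace_at p t u = t.
Proof.
elim: p t => [|i p IH] t; first by case: t => [v|f a] [<-].
by move=> /subterm_consP[f [a [j [-> -> /IH h]]]]; rewrite replace_App h setarg_id.
Qed.

Lemma subterm_replace V p (t u w : T V) : subterm_at p t = Some u -> subterm_at p (replace_at p t w) = Some w.
Proof.
elim: p t => [|i p IH] t; first by case: w.
move=> /subterm_consP[f [a [j [-> -> /IH h]]]].
by rewrite replace_App subterm_App ffunE eqxx.
Qed.

Lemma replace_replace V p (t u w : T V) : replace_at p (replace_at p t u) w = replace_at p t w.
Proof.
elim: p t => [|i p IH] t //; case: t => [//|f a] /=.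
case: insubP => [j _ e|n] /=; last by rewrite insubN.
by rewrite -e (valK j) ffunE eqxx IH setarg_set.
Qed.

Lemma subst_replace V W (s : V -> T W) p t u w : subterm_at p t = Some u ->
  subst s (replace_at p t w) = replace_at p (subst s t) (subst s w).
Proof.
elim: p t => [|i p IH] t //.
move=> /subterm_consP[f [a [j [-> -> /IH h]]]]; rewrite replace_App /= (valK j).
by congr App; apply/ffunP => k; rewrite !ffunE; case: eqP => // ->; rewrite h.
Qed.

Lemma replace_cat V p q (t u w : T V) : subterm_at p t = Some u ->
  replace_at (p ++ q) t w = replace_at p t (replace_at q u w).
Proof.
elim: p t => [|i p IH] t; first by case=> ->.
by move=> /subterm_consP[f [a [j [-> -> /IH h]]]]; rewrite cat_cons !replace_App h.
Qed.

Lemma occ_replace (V : eqType) x p (t u w : T V) : subterm_at p t = Some u ->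
  occ x (replace_at p t w) + occ x u = occ x t + occ x w.
Proof.
elim: p t => [|i p IH] t; first by case=> ->; rewrite /= addnC.
move=> /subterm_consP[f [a [j [-> -> /IH h]]]]; rewrite replace_App !occ_App.
rewrite (bigD1 j) //= ffunE eqxx [X in _ = X + _](bigD1 j) //=.
rewrite (eq_bigr (fun i => occ x (a i))); first by rewrite addnAC h addnAC.
by move=> k /negPf kj; rewrite ffunE kj.
Qed.

Lemma occ_subterm (V : eqType) x p (t u : T V) : subterm_at p t = Some u -> occ x u <= occ x t.
Proof.
elim: p t => [|i p IH] t; first by case=> ->.
move=> /subterm_consP[f [a [j [-> _ /IH h]]]]; rewrite occ_App (bigD1 j) //=.
exact: leq_trans h (leq_addr _ _).
Qed.

Lemma occ_subterm_ex (V : eqType) x (t : T V) : 0 < occ x t -> exists p, subterm_at p t = Some (Var x).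
Proof.
elim/term_rec_ffun: t => [v|f a IH].
  by rewrite /=; case: eqP => // -> _; exists [::].
rewrite occ_App_gt0 => /existsP[j /IH[p h]]; exists (nat_of_ord j :: p).
by rewrite subterm_App.
Qed.

(** By linearity [z] occurs nowhere else, so a change below it is a change of the substitution at
    [z]. *)
Lemma replace_subst (V : eqType) W (s : V -> T W) p t z w :
  subterm_at p t = Some (Var z) -> occ z t <= 1 ->
  replace_at p (subst s t) w = subst (fun y => if y == z then w else s y) t.
Proof.
elim: p t => [|i p IH] t; first by case=> ->; rewrite /= eqxx.
move=> /subterm_consP[f [a [j [-> -> h]]]]; rewrite occ_App (bigD1 j) //= => lin.
rewrite (valK j); congr App; apply/ffunP => k; rewrite !ffunE.
have hz : 0 < occ z (a j) by have := occ_subterm z h; rewrite /= eqxx.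
case: eqP => [->|/eqP kj]; first by apply: IH => //; move: lin; lia.
apply: eq_in_subst => v hv; case: eqP => // vz; rewrite vz in hv.
move: lin; rewrite (bigD1 k) //=; lia.
Qed.

Lemma cstep_pos V base (s t : T V) :
  cstep base s t <-> exists p l r, [/\ subterm_at p s = Some l, base l r & t = replace_at p s r].
Proof.
split.
  elim=> {s t} [l r h|f a i b _ [p [l [r [h1 h2 h3]]]]]; first by exists [::], l, r.
  exists (nat_of_ord i :: p), l, r; split=> //; first by rewrite subterm_App.
  by rewrite replace_App h3.
move=> [p [l [r [h1 h2 ->]]]]; elim: p s h1 => [|i p IH] s.
  by case=> ->; exact: cstep_root.
move=> /subterm_consP[f [a [j [-> -> /IH h]]]]; rewrite replace_App; exact: cstep_arg.
Qed.

Definition parallel (p q : seq nat) : Prop :=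
  exists r i j p' q', [/\ p = r ++ i :: p', q = r ++ j :: q' & i != j].

Lemma position_cases p q :
  [\/ exists q', q = p ++ q', exists2 p', p = q ++ p' & p' != [::] | parallel p q].
Proof.
elim: p q => [|i p IH] [|j q].
- by apply: Or31; exists [::].
- by apply: Or31; exists (j :: q).
- by apply: Or32; exists (i :: p).
case: (eqVneq i j) => [->|ne]; last first.
  by apply: Or33; exists [::], i, j, p, q.
case: (IH q) => [[q' ->]|[p' -> h]|[r [i' [j' [p' [q' [-> -> h]]]]]]].
- by apply: Or31; exists q'.
- by apply: Or32; exists p'.
- by apply: Or33; exists (j :: r), i', j', p', q'.
Qed.

Lemma subterm_replace_parallel V p q (t u w : T V) : parallel p q ->
  subterm_at p t = Some u -> subterm_at q (replace_at p t w) = subterm_at q t.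
Proof.
move=> [r [i [j [p' [q' [-> -> ne]]]]]]; elim: r t => [|k r IH] t.
  move=> /subterm_consP[f [a [i' [-> ei h]]]] /=; rewrite ei (valK i') /=.
  case: insubP => // j' _ ej; rewrite ffunE; case: eqP => // e.
  by rewrite ei -ej e eqxx in ne.
move=> /subterm_consP[f [a [i' [-> -> /IH h]]]]; rewrite !cat_cons replace_App !subterm_App.
by rewrite ffunE eqxx.
Qed.

Lemma occ_subterm_parallel (V : eqType) x p q (t u w : T V) : parallel p q ->
  subterm_at p t = Some u -> subterm_at q t = Some w -> occ x u + occ x w <= occ x t.
Proof.
move=> [r [i [j [p' [q' [-> -> ne]]]]]]; elim: r t => [|k r IH] t.
  move=> /subterm_consP[f [a [i' [-> ei h]]]] /subterm_consP[f' [a' [j' [e ej h']]]].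
  have ff : f = f' by case: e.
  subst f'; move/App_inj: e => e; rewrite -{}e {a'} in h'.
  rewrite occ_App (bigD1 i') //= (bigD1 j') /=.
    by have := occ_subterm x h; have := occ_subterm x h'; lia.
  by apply: contra ne => /eqP e; rewrite ei ej e.
move=> /subterm_consP[f [a [i' [-> -> h]]]]; rewrite cat_cons subterm_App => h'.
apply: leq_trans (IH _ h h') _; rewrite occ_App (bigD1 i') //=; lia.
Qed.

End Positions.

(** * Suffix overlaps *)

Section Suffix.
Variables (F : finType) (ar : F -> nat) (X : finType).
Local Notation T := (term ar).
Implicit Types (l r t u v : T X) (p q : seq nat).

Definition overlaps_at t u p : Prop :=
  exists s, [/\ subterm_at p t = Some s, ~~ is_var s, ~ (p = [::] /\ is_var u) &
    exists sg tau : X -> T X, subst sg s = subst tau u].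

(** Equal occurrence counts express that the context around the copy of [u] is ground. *)
Definition nested_at t u p : Prop :=
  exists rho : X -> X, [/\ injective rho, subterm_at p t = Some (rename rho u) &
    forall x, occ x t = occ x (rename rho u)].

Lemma nested_of_overlaps t u : (forall C, overlap t u C -> nested t u C) ->
  forall p, overlaps_at t u p -> nested_at t u p.
Proof.
move=> h p [s [hs nv nr uni]].
pose C := replace_at p (rename Some t) (Var None).
have hs' := subterm_subst (fun x => Var (Some x)) hs.
have occ0 t' : occ None (rename (@Some X) t' : T (option X)) = 0.
  apply/eqP; rewrite -leqn0 leqNgt; apply/negP; rewrite /rename => /occ_subst[x _].
  by [].
have fillC w : fill C w = replace_at p t w.
  rewrite /fill /C (subst_replace _ _ hs') subst_rename /=.
  by rewrite subst_var.
have oneC : one_hole C.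
  have := occ_replace None (Var None) hs'.
  by rewrite -/(rename _ _) -/(rename _ _) !occ0 /= addn0 add0n.
have [|c [rho [rI eC et]]] := h C.
  exists s; split=> //; first by rewrite fillC (replace_subterm hs).
  move=> [eV vu]; apply: nr; split=> //.
  move: eV; rewrite /C /rename; case: (p) hs' => // i p' /subterm_consP[f [a [j [-> -> _]]]].
  by rewrite replace_App.
have es : subterm_at p t = Some (rename rho u).
  by rewrite et -eC fillC; exact: subterm_replace hs.
exists rho; split=> // x.
have := occ_replace (Some x) (Var None) hs'.
rewrite -/(rename _ _) -/(rename _ _) -/C.
have -> : occ (Some x) C = 0.
  apply/eqP; rewrite -leqn0 leqNgt; apply/negP; rewrite eC /ctx_in /rename => /occ_subst[[[]|] _].
  by [].
have SI : injective (@Some X) by move=> ? ? [].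
rewrite !occ_rename_inj //= add0n addn0 => <-.
by move: es; rewrite hs => -[->].
Qed.

(** Outside [p] both terms are ground, and ground terms that unify are equal; at [p] both are copies
    of [a]. *)
Lemma agree p (s t a : T X) (sg tau : X -> T X) (rho1 rho2 : X -> X) (I2 : injective rho2) :
  subst sg s = subst tau t ->
  subterm_at p s = Some (rename rho1 a) -> subterm_at p t = Some (rename rho2 a) ->
  (forall x, occ x s = occ x (rename rho1 a)) ->
  (forall x, occ x t = occ x (rename rho2 a)) ->
  s = rename (fun x => rho1 (invF I2 x)) t.
Proof.
elim: p s t => [|i p IH] s t.
  move=> _ [->] [->] _ _; rewrite rename_comp; apply: subst_ext => x.
  by rewrite invF_f.
move=> e /subterm_consP[f [b [j [es ei h1]]]] /subterm_consP[f' [c [j' [et ej h2]]]].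
subst s t.
have {}e : App f [ffun i => subst sg (b i)] = App f' [ffun i => subst tau (c i)] := e.
have ff : f' = f by case: e => e _; exact: esym.
subst f'; have jj : j' = j by apply: val_inj; rewrite -ei -ej.
subst j'; move/App_inj/ffunP: e => e o1 o2.
have ob k x : k != j -> occ x (b k) = 0.
  have := o1 x; rewrite occ_App (bigD1 j) //=; have := occ_subterm x h1 => o e1 kj.
  have E S : occ x (b j) + S = occ x (rename rho1 a) -> S = 0 by move: o; lia.
  by move/E/eqP: e1; rewrite sum_nat_eq0 => /forallP/(_ k)/implyP/(_ kj)/eqP.
have oc k x : k != j -> occ x (c k) = 0.
  have := o2 x; rewrite occ_App (bigD1 j) //=; have := occ_subterm x h2 => o e1 kj.
  have E S : occ x (c j) + S = occ x (rename rho2 a) -> S = 0 by move: o; lia.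
  by move/E/eqP: e1; rewrite sum_nat_eq0 => /forallP/(_ k)/implyP/(_ kj)/eqP.
rewrite /rename [RHS]/=; congr App; apply/ffunP => k; have := e k; rewrite !ffunE.
have [->|kj] := eqVneq k j.
  move=> ek; apply: IH ek h1 h2 _ _ => x.
    rewrite -o1 occ_App (bigD1 j) //= big1 ?addn0 // => k' kj; exact: ob.
  by rewrite -o2 occ_App (bigD1 j) //= big1 ?addn0 // => k' kj; exact: oc.
by rewrite /rename !subst_closed // => x; first [exact: ob|exact: oc].
Qed.

Variable R : set (T X * T X).
Hypothesis R_trs : is_trs R.
Hypothesis R_lin : linear_trs R.
Hypothesis R_suffix : suffix_trs R.

Definition lhs l := exists r, R (l, r).
Definition rhs r := exists l, R (l, r).

Lemma suffix_lr l r p : lhs l -> rhs r -> overlaps_at l r p -> nested_at l r p.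
Proof.
by move=> [r0 h1] [l0 h2]; apply: nested_of_overlaps => C; have [] := R_suffix h2 h1 C.
Qed.

Lemma suffix_rl l r p : lhs l -> rhs r -> overlaps_at r l p -> nested_at r l p.
Proof.
by move=> [r0 h1] [l0 h2]; apply: nested_of_overlaps => C; have [] := R_suffix h2 h1 C.
Qed.

(** Adding a good term as a right-hand side would not break the suffix
    condition. *)
Definition good v := forall l, lhs l -> forall p,
  (overlaps_at v l p -> nested_at v l p) /\ (overlaps_at l v p -> nested_at l v p).

Lemma good_rhs r : rhs r -> good r.
Proof. by move=> hr l hl p; split; [exact: suffix_rl|exact: suffix_lr]. Qed.

Lemma is_var_rename V W (h : V -> W) (t : T V) : is_var (rename h t) = is_var t.
Proof. by case: t. Qed.

Lemma occ_rename_eq (rho : X -> X) t u : injective rho ->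
  (forall x, occ x t = occ x u) -> forall x, occ x (rename rho t) = occ x (rename rho u).
Proof.
move=> rI h x; have [y <-] : exists y, rho y = x by exists (invF rI x); rewrite f_invF.
by rewrite !occ_rename_inj.
Qed.

Lemma overlaps_at_cat t u p q s w (sg : X -> T X) (tau : X -> T X) :
  subterm_at p t = Some s -> subterm_at q s = Some w -> ~~ is_var w ->
  ~ (p ++ q = [::] /\ is_var u) -> subst sg w = subst tau u -> overlaps_at t u (p ++ q).
Proof.
by move=> h1 h2 nv ex e; exists w; split=> //; [rewrite subterm_cat h1|exists sg, tau].
Qed.

(** * Stability of good terms under a merged step *)

Section GoodStep.
Variables (v l' r' : T X) (rho : X -> X) (p : seq nat).
Hypothesis v_good : good v.
Hypothesis R' : R (l', r').
Hypothesis rI : injective rho.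
Hypothesis v_sub : subterm_at p v = Some (rename rho l').
Hypothesis v_occ : forall x, occ x v = occ x (rename rho l').
Hypothesis l'_nv : ~~ is_var l'.

Let v' := replace_at p v (rename rho r').

Let lhs' : lhs l'. Proof. by exists r'. Qed.
Let rhs' : rhs r'. Proof. by exists l'. Qed.

Let v'_sub : subterm_at p v' = Some (rename rho r').
Proof. exact: subterm_replace v_sub. Qed.

Let vE : v = replace_at p v' (rename rho l').
Proof. by rewrite replace_replace (replace_subterm v_sub). Qed.

Lemma occ_v' x : occ x v' = occ x (rename rho r').
Proof. by have := occ_replace x (rename rho r') v_sub; rewrite v_occ -/v'; lia. Qed.

Lemma good_step_below l q : lhs l -> overlaps_at v' l (p ++ q) -> nested_at v' l (p ++ q).
Proof.
move=> hl [s]; rewrite subterm_cat v'_sub /= => -[hs nv ex [sg [tau uni]]].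
case: (subterm_subst_inv hs) => [[s1 [h1 nv1 es]]|[p1 [p2 [x [_ _]]]]]; last first.
  by case: p2 => [[es]|//]; rewrite -es in nv.
(* A variable [l] at the root of the copy is no overlap of [r'], but it would overlap [v] at [p] and
   force [l'] to be a variable. *)
case: (boolP ((q == [::]) && is_var l)) => [/andP[/eqP q0 vl]|ex'].
  have [|rho2 [_ e _]] := (v_good hl p).1.
    exists (rename rho l'); split=> //; first by rewrite is_var_rename.
      by move=> [p0 _]; apply: ex; rewrite p0 q0.
    case: l vl {hl uni ex} => // z _.
    by exists Var, (fun=> rename rho l'); rewrite subst_var.
  by move: l'_nv; rewrite -(is_var_rename rho); move: e; rewrite v_sub => -[->]; rewrite is_var_rename vl.
have [|rho2 [rI2 e2 o2]] := suffix_rl hl rhs' (p := q).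
  exists s1; split=> //; first by move=> [q0 vl]; rewrite q0 vl in ex'.
  by exists (fun x => sg (rho x)), tau; rewrite -uni es /rename subst_comp.
have rr : injective (fun x => rho (rho2 x)) by move=> x y /rI/rI2.
exists (fun x => rho (rho2 x)); split=> //.
  by rewrite subterm_cat v'_sub /= (subterm_subst _ e2) -/(rename _ _) rename_comp.
by move=> x; rewrite occ_v' -(rename_comp rho2 rho); apply: occ_rename_eq.
Qed.

Lemma linear_lhs l : lhs l -> linear l.
Proof. by move=> [r /R_lin[]]. Qed.

Lemma nonvar_below_var (s t : T X) (h : X -> X) p1 p2 z :
  subterm_at p1 t = Some (Var z) -> subterm_at (p1 ++ p2) (rename h t) = Some s -> is_var s.
Proof.
move=> h1; rewrite subterm_cat (subterm_subst _ h1) /=.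
by case: p2 => [[<-]|].
Qed.

Lemma good_step_above l q p' : lhs l -> p = q ++ p' -> p' != [::] ->
  overlaps_at v' l q -> nested_at v' l q.
Proof.
move=> hl ep p'0 [s [hs nv ex [sg [tau uni]]]].
have hs' : subterm_at p' s = Some (rename rho r').
  by move: v'_sub; rewrite ep subterm_cat hs.
have [s0 hs0] : exists s0, subterm_at q v = Some s0.
  by move: v_sub; rewrite ep subterm_cat; case: (subterm_at q v) => // s0 _; exists s0.
have hs0' : subterm_at p' s0 = Some (rename rho l') by move: v_sub; rewrite ep subterm_cat hs0.
have es : s = replace_at p' s0 (rename rho r').
  by have := hs; rewrite /v' ep (replace_cat _ _ hs0) (subterm_replace _ hs0) => -[<-].
have es0 : s0 = replace_at p' s (rename rho l') by rewrite es replace_replace (replace_subterm hs0').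
have occ_s x : occ x s = occ x (rename rho r').
  have := occ_subterm x hs; have := occ_subterm x hs'; rewrite occ_v'; lia.
have hl2 := subterm_subst sg hs'; rewrite uni in hl2.
case: (subterm_subst_inv hl2) => [[s2 [h2 nv2 e2]]|[p1 [p2 [z [ep' h2 _]]]]].
  have [|rho2 [rI2 e3 o3]] := suffix_lr hl rhs' (p := p').
    exists s2; split=> //; first by case: (p') p'0 => // ? ? _ [].
    by exists tau, (fun x => sg (rho x)); rewrite -e2 /rename subst_comp.
  have eqs := agree rI2 uni hs' e3 occ_s o3.
  exists (fun x => rho (invF rI2 x)); split.
  - by move=> x y /rI; apply: (can_inj (f_invF rI2)).
  - by rewrite hs eqs.
  - by move=> x; rewrite -eqs occ_s occ_v'.
have [|rho2 [rI2 e3 o3]] := (v_good hl q).1.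
  exists s0; split=> //.
    by move: hs0' l'_nv; case: (p') p'0 => // i p'' _ /subterm_consP[f [a [j [-> _ _]]]].
  exists sg, (fun y => if y == z then replace_at p2 (tau z) (subst sg (rename rho l')) else tau y).
  rewrite es0 (subst_replace _ _ hs') uni ep' (replace_cat _ _ (subterm_subst tau h2)).
  by apply: replace_subst; last exact: linear_lhs.
have : is_var (rename rho l').
  apply: (nonvar_below_var (h := rho2) (p2 := p2) h2); rewrite -ep'.
  by move: e3; rewrite hs0 => -[<-].
by rewrite is_var_rename (negPf l'_nv).
Qed.

(** Here [l] overlaps [v] as well, so all the variables of [v] lie both at [p] and at [q]. Hence [v]
    has none, and neither has [v'], since [r'] brings no variable beyond those of [l']. *)
Lemma good_step_parallel l q : lhs l -> parallel p q -> overlaps_at v' l q -> nested_at v' l q.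
Proof.
move=> hl par [s [hs nv ex [sg [tau uni]]]].
have hs0 : subterm_at q v = Some s by rewrite -hs /v' (subterm_replace_parallel _ par v_sub).
have [|rho2 [rI2 e3 o3]] := (v_good hl q).1.
  by exists s; split=> //; exists sg, tau.
exists rho2; split=> //; first by rewrite hs -hs0.
have es : s = rename rho2 l by move: e3; rewrite hs0 => -[].
move=> x; have := occ_subterm_parallel x par v_sub hs0; rewrite -v_occ es -o3 => h.
have ov0 : occ x v = 0 by lia.
rewrite ov0 occ_v'.
have [y ey] : exists y, rho y = x by exists (invF rI x); rewrite f_invF.
rewrite -{x h}ey in ov0 *.
apply/eqP; rewrite occ_rename_inj // -leqn0 leqNgt; apply/negP => hy.
by have := R_trs R' hy; rewrite /in_vars -(occ_rename_inj _ _ rI) -v_occ ov0.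
Qed.

(** The dichotomy of [good_step_above], with [v'] now placed inside [l]. *)
Lemma good_step_lhs l q : lhs l -> overlaps_at l v' q -> nested_at l v' q.
Proof.
move=> hl [s [hs nv ex [sg [tau uni]]]].
have h1 : subterm_at p (subst sg s) = Some (subst tau (rename rho r')).
  by rewrite uni; exact: subterm_subst.
case: (subterm_subst_inv h1) => [[s2 [h2 nv2 e2]]|[p1 [p2 [z [ep h2 _]]]]].
  have [|rho2 [rI2 e3 o3]] := suffix_lr hl rhs' (p := q ++ p).
    apply: (overlaps_at_cat hs h2 nv2 (sg := sg) (tau := fun x => tau (rho x))).
      move=> [qp0 vr]; apply: ex.
      have [q0 p0] : q = [::] /\ p = [::] by move: qp0; case: (q) => //; case: (p).
      by split=> //; move: v'_sub; rewrite p0 => -[->]; rewrite is_var_rename.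
    by rewrite -e2 /rename subst_comp.
  have e4 : subterm_at p s = Some (rename rho2 r') by move: e3; rewrite subterm_cat hs.
  have occ_s x : occ x s = occ x (rename rho2 r').
    have := occ_subterm x hs; have := occ_subterm x e4; rewrite o3; lia.
  have eqs := agree rI uni e4 v'_sub occ_s occ_v'.
  exists (fun x => rho2 (invF rI x)); split.
  - by move=> x y /rI2; apply: (can_inj (f_invF rI)).
  - by rewrite hs eqs.
  - by move=> x; rewrite -eqs occ_s o3.
have [|rho2 [rI2 e3 o3]] := (v_good hl q).2.
  exists s; split=> //.
    by move=> [_]; move: v_sub l'_nv; case: (v) => // y; case: (p) => // -[e];
       rewrite -(is_var_rename rho) -e.
  exists (fun y => if y == z then replace_at p2 (sg z) (subst tau (rename rho l')) else sg y), tau.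
  rewrite vE (subst_replace _ _ v'_sub) -uni ep (replace_cat _ _ (subterm_subst sg h2)).
  symmetry; apply: replace_subst => //; apply: leq_trans (occ_subterm z hs) _.
  exact: linear_lhs.
have es : s = rename rho2 v by move: e3; rewrite hs => -[].
have := subterm_subst (fun x => Var (rho2 x)) v_sub; rewrite -/(rename _ _) -es ep subterm_cat h2 /=.
case: (p2) => [[e5]|//]; have := l'_nv.
by rewrite -(is_var_rename rho) -(is_var_rename rho2) /rename -e5.
Qed.

Lemma good_step : good v'.
Proof.
move=> l hl q; split; last exact: good_step_lhs.
case: (position_cases p q) => [[q' ->]|[p' ep p'0]|par].
- exact: good_step_below.
- exact: good_step_above ep p'0.
- exact: good_step_parallel.
Qed.

End GoodStep.
End Suffix.

(** * Derivations *)

Section Derivation.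
Variables (F : finType) (ar : F -> nat) (X : finType).
Local Notation T := (term ar).
Variable R : set (T X * T X).
Hypothesis R_trs : is_trs R.
Hypothesis R_lin : linear_trs R.
Hypothesis R_suffix : suffix_trs R.

Definition instance_rule (s t : T void) : Prop :=
  exists l r (sg : X -> T void), [/\ R (l, r), s = subst sg l & t = subst sg r].

Lemma rewrite_stepE s t : rewrite_step R s t <-> cstep instance_rule s t.
Proof.
rewrite cstep_pos; split.
  move=> [l [r [[c /= /eqP c1] [sg [Rlr -> ->]]]]].
  have [p hp] : exists p, subterm_at p c = Some (Var None) by apply: occ_subterm_ex; rewrite c1.
  exists p, (subst sg l), (subst sg r); split; first 2 last.
  - rewrite /fill (replace_subst _ _ hp) ?c1 //; apply: subst_ext => -[[]|] //.
  - by rewrite /fill (subterm_subst _ hp).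
  - by exists l, r, sg.
move=> [p [l0 [r0 [hp [l [r [sg [Rlr el er]]]] ->]]]]; subst l0 r0.
have hp' := subterm_subst (fun x => Var (Some x)) hp.
pose c := replace_at p (rename Some s) (Var None).
have occ0 t' : occ None (rename (@Some void) t' : T (option void)) = 0.
  by apply/eqP; rewrite -leqn0 leqNgt; apply/negP; rewrite /rename => /occ_subst[].
have c1 : occ None c == 1.
  have := occ_replace None (Var None) hp'.
  by rewrite -/(rename _ _) -/(rename _ _) !occ0 /= addn0 add0n => ->.
have fillc w : fill c w = replace_at p s w.
  rewrite /fill /c (subst_replace _ _ hp') subst_rename /=; congr replace_at.
  exact: ground_id.
exists l, r, (exist _ c c1), sg; split=> //=; rewrite fillc //.
by rewrite (replace_subterm hp).
Qed.

(** [None] is the junk constant: the rule [t -> None] forgets a subterm which a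
    later step erases, so that the automata need not remember it. *)
Definition marked_rule (s t : T (option X)) : Prop :=
  (exists l r (eta : X -> option X), [/\ R (l, r), s = rename eta l & t = rename eta r]) \/
  t = Var None.

Local Notation msteps := (csteps marked_rule).

Lemma rename_setarg V W (h : V -> W) f (a : {ffun 'I_(ar f) -> T V}) i b :
  rename h (App f (setarg a i b)) = App f (setarg [ffun j => rename h (a j)] i (rename h b)).
Proof. by congr App; apply/ffunP => j; rewrite !ffunE; case: eqP. Qed.

Lemma msteps_rename (h : option X -> option X) u w : h None = None ->
  msteps u w -> msteps (rename h u) (rename h w).
Proof.
move=> h0; elim=> {u w} [u w st|u|u w v _ IH1 _ IH2]; [|exact: rt_refl|exact: rt_trans IH1 IH2].
apply: rt_step; elim: st => {u w} [u w|f a i b _ IH].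
  case=> [[l [r [eta [Rlr -> ->]]]]|->]; apply: cstep_root.
    by left; exists l, r, (fun x => h (eta x)); rewrite !rename_comp.
  by right; rewrite /rename /= h0.
rewrite rename_setarg /rename /= -/(rename h); apply: cstep_arg.
by rewrite ffunE.
Qed.

Lemma matches_rename (s s' : X -> T void) (h : option X -> option X) u t :
  (forall o t', matches s (Var o) t' -> matches s' (Var (h o)) t') ->
  matches s u t -> matches s' (rename h u) t.
Proof.
move=> hh; elim/term_rec_ffun: u t => [o|f a IH] t; first exact: hh.
move=> [b -> hb]; exists b => // i; rewrite ffunE; exact: IH (hb i).
Qed.

Lemma matches_Some (s : X -> T void) (v : T X) t :
  matches s (rename Some v) t <-> t = subst s v.
Proof.
elim/term_rec_ffun: v t => [x|f a IH] t //=.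
split.
  move=> [b -> hb]; congr App; apply/ffunP => i; rewrite ffunE; apply/IH.
  by have := hb i; rewrite ffunE.
move=> ->; eexists; first reflexivity.
by move=> i; rewrite !ffunE; apply/IH.
Qed.

Lemma occ_arg_uniq (V : eqType) (x : V) f (a : {ffun 'I_(ar f) -> T V}) i j :
  occ x (App f a) <= 1 -> 0 < occ x (a i) -> 0 < occ x (a j) -> i = j.
Proof.
move=> lin hi hj; apply/eqP; apply: contraT => ij; move: lin.
by rewrite occ_App (bigD1 i) //= (bigD1 j) 1?eq_sym //=; lia.
Qed.

Lemma linear_arg (V : eqType) f (a : {ffun 'I_(ar f) -> T V}) i :
  linear (App f a) -> linear (a i).
Proof.
move=> lin x; apply: leq_trans (lin x); rewrite occ_App (bigD1 i) //=.
exact: leq_addr.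
Qed.

Lemma occ_rename_at (V W : eqType) (h : V -> W) w w' (t : T V) :
  (forall v, (w' == h v) = (w == v)) -> occ w' (rename h t) = occ w t.
Proof.
move=> hh; elim/term_rec_ffun: t => [v|f a IH]; first by rewrite /= hh.
rewrite !occ_App; apply: eq_bigr => i _; rewrite ffunE; exact: IH.
Qed.

Lemma glue_linear A f (la : {ffun 'I_(ar f) -> T X}) (sg : 'I_(ar f) -> X -> A) (d : X -> A) :
  linear (App f la) -> exists tau : X -> A,
    (forall i x, 0 < occ x (la i) -> tau x = sg i x) /\
    (forall x, tau x = d x \/ exists i, tau x = sg i x).
Proof.
move=> lin; exists (fun x => if [pick i | 0 < occ x (la i)] is Some i then sg i x else d x).
split=> [i x h|x]; case: pickP => [j hj|h0].
- by rewrite (occ_arg_uniq (lin x) h hj).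
- by rewrite h0 in h.
- by right; exists j.
- by left.
Qed.

(** [eta] may identify variables or turn them into junk, which matches different terms at different
    places; linearity of [l] still leaves one value per variable. *)
Lemma matches_linear (s : X -> T void) (eta : X -> option X) l t : linear l ->
  matches s (rename eta l) t -> exists th : X -> T void,
    t = subst th l /\ forall x, 0 < occ x l -> matches s (Var (eta x)) (th x).
Proof.
elim/term_rec_ffun: l t => [x|f a IH] t lin.
  move=> h; exists (fun=> t); split=> // y /=; by case: eqP => // ->.
move=> [b et hb].
have : forall i, exists th : X -> T void, b i = subst th (a i) /\
    forall x, 0 < occ x (a i) -> matches s (Var (eta x)) (th x).
  move=> i; apply: IH; first exact: linear_arg lin.
  by have := hb i; rewrite ffunE.
move=> /choice[th hth]; have [tau [ht _]] := glue_linear th (fun=> t) lin.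
exists tau; split.
  rewrite et /=; congr App; apply/ffunP => i; rewrite ffunE (hth i).1.
  by apply: eq_in_subst => x hx; rewrite (ht i).
move=> x; rewrite occ_App_gt0 => /existsP[i hi]; rewrite (ht _ _ hi).
exact: (hth i).2.
Qed.

Lemma marked_step_sound u w (s : X -> T void) t : cstep marked_rule u w -> matches s u t ->
  exists2 t', csteps instance_rule t t' & matches s w t'.
Proof.
move=> st; elim: st t => {u w} [u w h|f a i b _ IH] t.
  case: h => [[l [r [eta [Rlr -> ->]]]]|->]; last by exists t => //; exact: rt_refl.
  move=> h0; have [th [-> h]] := matches_linear (R_lin Rlr).1 h0.
  move=> {h0}.
  exists (subst th r); first by apply/rt_step/cstep_root; exists l, r, th.
  have {}h x : 0 < occ x r -> matches s (Var (eta x)) (th x).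
    by move=> hx; apply: h; exact: (R_trs Rlr hx).
  elim/term_rec_ffun: r h {Rlr} => [x|f a IH] h.
    by apply: h; rewrite /= eqxx.
  eexists; first reflexivity.
  by move=> i; rewrite !ffunE; apply: IH => x hx; apply: h; exact: occ_arg_gt0 hx.
move=> [c -> hc]; have [t' h1 h2] := IH _ (hc i).
exists (App f (setarg c i t')); first exact: csteps_arg.
exists (setarg c i t') => // j; rewrite !ffunE; case: eqP => // _; exact: hc.
Qed.

Lemma marked_sound u w (s : X -> T void) t : msteps u w -> matches s u t ->
  exists2 t', csteps instance_rule t t' & matches s w t'.
Proof.
move=> st; elim: st t => {u w} [u w st|u|u v w _ IH1 _ IH2] t h.
- exact: marked_step_sound st h.
- by exists t => //; exact: rt_refl.
- have [t1 s1 /IH2[t2 s2 h2]] := IH1 _ h.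
  by exists t2 => //; exact: rt_trans s1 s2.
Qed.

(** Junk must be absent from [v], since two terms matched by [None] are unrelated. *)
Lemma matches_csteps (s1 s2 : X -> T void) v t1 t2 : occ None v = 0 ->
  (forall x, csteps instance_rule (s1 x) (s2 x)) -> matches s1 v t1 -> matches s2 v t2 ->
  csteps instance_rule t1 t2.
Proof.
move=> + hs; elim/term_rec_ffun: v t1 t2 => [[x|]|f a IH] t1 t2 //=.
  by move=> _ -> ->.
move=> /eqP; rewrite sum_nat_eq0 => /forallP h0 [b1 -> h1] [b2 -> h2].
apply: csteps_app => i; apply: IH (h1 i) (h2 i).
by apply/eqP/(implyP (h0 i)).
Qed.

(** * Pairs of terms traced by chains *)

Local Notation good := (good R).

(** Compared with [linked], the chain is explicit and ends in a [good] term free of junk, so it can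
    be prolonged; variables lost in [v] may still be named in [u]. *)
Inductive traced : T void -> T void -> Prop :=
| traced_cong f (a b : {ffun 'I_(ar f) -> T void}) :
    (forall i, traced (a i) (b i)) -> traced (App f a) (App f b)
| traced_rule l r u v (sg tau : X -> T void) s t : R (l, r) ->
    msteps u (rename Some l) -> msteps (rename Some r) (rename Some v) ->
    good v -> linear v -> (forall x, occ x v <= occ (Some x) u <= 1) ->
    matches sg u s -> (forall x, traced (sg x) (tau x)) -> t = subst tau v -> traced s t.

Lemma traced_refl t : traced t t.
Proof. by elim/term_rec_ffun: t => // f a IH; exact: traced_cong. Qed.

Lemma rhs_occ l r x : R (l, r) -> occ x r <= occ x l.
Proof.
move=> Rlr; have [_ /(_ x)] := R_lin Rlr; case e: (occ x r) => [|[|n]] // _.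
by apply: (R_trs Rlr); rewrite /in_vars e.
Qed.

(** [s] is an instance of a term that derives [l], the variables of [l] standing
    for subterms that evolve independently. *)
Definition pulled (th : X -> T void) s l : Prop :=
  exists u (sg : X -> T void), [/\ msteps u (rename Some l),
    forall x, occ (Some x) u = occ x l, matches sg u s &
    forall x, traced (sg x) (th x)].

Lemma pulled_var th s x : traced s (th x) -> pulled th s (Var x).
Proof.
move=> h; exists (Var (Some x)), (fun y => if y == x then s else th y); split.
- exact: rt_refl.
- by [].
- by rewrite /= eqxx.
- by move=> y; case: eqP => [->|_] //; exact: traced_refl.
Qed.

Lemma pulled_app th f (a : {ffun 'I_(ar f) -> T void}) (la : {ffun 'I_(ar f) -> T X}) :
  linear (App f la) -> (forall i, pulled th (a i) (la i)) -> pulled th (App f a) (App f la).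
Proof.
move=> lin /choice[u /choice[sg h]]; have [tau [h1 h2]] := glue_linear sg th lin.
exists (App f (finfun u)), tau; split.
- by apply: csteps_app => i; rewrite !ffunE; case: (h i).
- by move=> x; rewrite !occ_App; apply: eq_bigr => i _; rewrite ffunE; case: (h i).
- eexists; first reflexivity.
  move=> i; rewrite ffunE; have [_ ho hi _] := h i; apply: matches_ext hi => x.
  by rewrite ho => hx; rewrite (h1 i).
- by move=> x; case: (h2 x) => [->|[i ->]]; [exact: traced_refl|case: (h i)].
Qed.

Lemma pulled_step th l r s : R (l, r) -> pulled th s l -> traced s (subst th r).
Proof.
move=> Rlr [u [sg [h1 h2 h3 h4]]]; have [ll lr] := R_lin Rlr.
apply: (traced_rule Rlr h1 _ _ lr _ h3 h4 erefl); first exact: rt_refl.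
  by apply: good_rhs => //; exists l.
by move=> x; rewrite h2 ll (rhs_occ _ Rlr).
Qed.

Lemma overlaps_at_ground (t u s : T X) p (th tau : X -> T void) : subterm_at p t = Some s ->
  ~~ is_var s -> ~ (p = [::] /\ is_var u) -> subst th s = subst tau u -> overlaps_at t u p.
Proof.
move=> h1 nv ex e; exists s; split=> //.
exists (fun x => of_ground X (th x)), (fun x => of_ground X (tau x)).
by rewrite /of_ground /rename -!subst_comp e.
Qed.

(** The proof descends through the congruences of the trace. Where a chain ending in [v] is met, [v]
    overlaps [l] at [q], so [l'] is a renaming of [v] and the renamed chain derives [l']. The
    condition on [q] is there for a variable [v], which overlaps [l] only strictly below the
    root. *)
Lemma traced_pull l q l' th s t : lhs R l -> subterm_at q l = Some l' -> q != [::] ->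
  traced s t -> t = subst th l' -> pulled th s l'.
Proof.
move=> hl; elim/term_rec_ffun: l' q s t => [x|f la IH] q s t hq q0.
  by move=> h e; apply: pulled_var; rewrite e in h.
case=> {s t} [f' a b hab|l0 r0 u v sg tau s t R0 s1 s2 nt_var lv ouv hi hst ->].
  move=> e; have ff : f' = f by case: e.
  subst f'; move/App_inj: e => e; apply: pulled_app.
    by move=> x; apply: leq_trans (occ_subterm x hq) _; exact: (linear_lhs R_lin hl).
  move=> i; apply: (IH i (q ++ [:: nat_of_ord i]) _ _ _ _ (hab i)).
  - by rewrite subterm_cat hq /= (valK i).
  - by case: (q).
  - by rewrite e ffunE.
move=> e; have [|rho [rI e1 e2]] := (nt_var _ hl q).2.
  apply: (overlaps_at_ground hq _ _ (esym e)) => //.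
  by move=> [q00]; rewrite q00 in q0.
have {e1} el : App f la = rename rho v by move: e1; rewrite hq => -[].
rewrite el in e *; move: e; rewrite subst_rename => e.
(* Variables erased along the chain become junk, so that the pattern keeps exactly the variables of
   [l']. *)
pose h o := if o is Some x then (if 0 < occ x v then Some (rho x) else None) else None.
have hE : rename h (rename Some v) = rename Some (rename rho v) :> T (option X).
  by rewrite !rename_comp; apply: eq_in_subst => x hx; rewrite /h hx.
exists (rename h u), (fun y => if 0 < occ y (rename rho v) then sg (invF rI y) else th y); split.
- rewrite -hE; apply: msteps_rename => //.
  apply: rt_trans s1 (rt_trans _ _ _ _ _ _ s2); apply/rt_step/cstep_root.
  by left; exists l0, r0, Some.
- move=> y; have [x <-] : exists x, rho x = y by exists (invF rI y); rewrite f_invF.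
  rewrite occ_rename_inj //; have /andP[le1 le2] := ouv x.
  case: (posnP (occ x v)) => [x0|xv].
    rewrite x0; apply/eqP; rewrite -leqn0 leqNgt; apply/negP.
    rewrite /rename => /occ_subst[[z|] _] //=; rewrite /h; case: ifP => // zv.
    by rewrite /= -[Some _ == _]/(rho x == rho z) (inj_eq rI); case: eqP => // xz; rewrite -xz x0 in zv.
  rewrite (occ_rename_at (w := Some x)).
    by apply/eqP; rewrite eqn_leq le1 andbT; exact: leq_trans le2 xv.
  move=> [z|] //=; rewrite /h; case: ifP => [zv|zv].
    by rewrite -[LHS]/(rho x == rho z) (inj_eq rI).
  by apply/esym/negP => /eqP[xz]; rewrite -xz xv in zv.
- apply: matches_rename hi => -[z|] //= t' ->; rewrite /h; case: ifP => //= zv.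
  by rewrite occ_rename_inj // zv invF_f.
- move=> y; case: ifP => hy; last exact: traced_refl.
  have yE : rho (invF rI y) = y by rewrite f_invF.
  rewrite -yE occ_rename_inj // in hy.
  by rewrite -[in th y]yE -(subst_inj_in e hy).
Qed.

Lemma traced_root_var th x r s : R (Var x, r) -> traced s (th x) -> traced s (subst th r).
Proof. by move=> Rxr h; apply: pulled_step Rxr _; exact: pulled_var. Qed.

Lemma traced_step s t p l r th : traced s t -> R (l, r) -> subterm_at p t = Some (subst th l) ->
  traced s (replace_at p t (subst th r)).
Proof.
move=> h Rlr; have hl : lhs R l by exists r.
elim: h p => {s t} [f a b hab IH|l0 r0 u v sg tau s t R0 s1 s2 nt_var lv ouv hi hst IH et] p.
  case: p => [|i p].
    move=> [e] /= {IH}; case: l e hl Rlr => [x|f' la] e hl Rlr.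
      by apply: traced_root_var Rlr _; rewrite -[th x]e; exact: traced_cong.
    have ff : f' = f by case: e.
    subst f'; move/App_inj: e => e; apply: (pulled_step Rlr).
    apply: pulled_app; first by case: (R_lin Rlr).
    move=> i; apply: (traced_pull (q := [:: nat_of_ord i]) hl _ _ (hab i)) => //.
      by rewrite /= (valK i).
    by rewrite e ffunE.
  rewrite /=; case: insubP => // j _ _ hp; apply: traced_cong => k.
  by rewrite ffunE; case: eqP => // ->; exact: IH.
rewrite et => hp.
case: (subterm_subst_inv hp) => [[w [hw nw ew]]|[p1 [p2 [z [ep h1 h2]]]]]; last first.
  rewrite ep (replace_cat _ _ (subterm_subst tau h1)) (replace_subst _ _ h1) ?lv //.
  apply: (traced_rule R0 s1 s2 nt_var lv ouv hi _ erefl) => x.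
  by case: eqP => [->|_] //; exact: IH.
(* A variable left-hand side at the root of [v] is no overlap; the step opens a new chain whose
   variable is bound to the whole traced pair. *)
case: (boolP ((p == [::]) && is_var l)) => [/andP[/eqP p0 vl]|ex].
  rewrite p0 /= in hp *; case: l vl Rlr hp {hl ew IH} => // x _ Rlr [e].
  apply: traced_root_var Rlr _; rewrite -[th x]e.
  exact: (traced_rule R0 s1 s2 nt_var lv ouv hi hst erefl).
have [|rho [rI e1 o1]] := (nt_var _ hl p).1.
  apply: (overlaps_at_ground hw nw _ (esym ew)).
  by move=> [p0 vl]; rewrite p0 vl in ex.
have nl : ~~ is_var l by move: e1 nw; rewrite hw => -[->]; rewrite is_var_rename.
have e : subst th r = subst tau (rename rho r).
  rewrite subst_rename; apply: eq_in_subst => x hx.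
  move: ew; have := e1; rewrite hw => -[->]; rewrite subst_rename => /subst_inj_in; apply.
  exact: (R_trs Rlr hx).
rewrite e -(subst_replace _ _ hw).
have occ' x : occ x (replace_at p v (rename rho r)) <= occ x v.
  have := occ_replace x (rename rho r) e1; rewrite -o1 addnC => /addnI ->.
  have [y <-] : exists y, rho y = x by exists (invF rI x); rewrite f_invF.
  by rewrite o1 !occ_rename_inj //; exact: rhs_occ Rlr.
apply: (traced_rule R0 s1 _ _ _ _ hi hst erefl).
- apply: rt_trans s2 _; apply/rt_step/cstep_pos.
  exists p, (rename Some (rename rho l)), (rename Some (rename rho r)); split.
  + exact: subterm_subst e1.
  + by left; exists l, r, (fun x => Some (rho x)); rewrite !rename_comp.
  + by rewrite /rename (subst_replace _ _ e1).
- exact: (good_step R_trs R_lin R_suffix nt_var Rlr rI e1 o1 nl).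
- by move=> x; exact: leq_trans (occ' x) (lv x).
- by move=> x; have /andP[h1 ->] := ouv x; rewrite andbT (leq_trans (occ' x)).
Qed.

Lemma derivation_traced s t : derivation R s t -> traced s t.
Proof.
move=> /clos_rt_rtn1_iff h; elim: h => [|t1 t2 st _ IH]; first exact: traced_refl.
move/rewrite_stepE/cstep_pos: st => [p [l0 [r0 [hp [l [r [sg [Rlr el er]]]] ->]]]].
by rewrite er; apply: traced_step IH Rlr _; rewrite hp el.
Qed.

Lemma derivationE s t : derivation R s t <-> csteps instance_rule s t.
Proof.
split; (elim=> {s t} [s t st|s|s t u _ IH1 _ IH2]; [|exact: rt_refl|exact: rt_trans IH1 IH2]).
  by apply/rt_step/rewrite_stepE.
by apply/rt_step/rewrite_stepE.
Qed.

(** * From traced pairs to linked pairs *)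

Section Automata.
Variables (Q : finType) (vt0 : option X -> Q -> Prop).
Variable at0 : forall f : F, {ffun 'I_(ar f) -> Q} -> Q -> Prop.
Variable W : Q -> Q -> Prop.
Hypothesis marked_ruleE : rule_base vt0 at0 W = marked_rule.
Variables (vt : bool -> option X -> Q -> Prop).
Variable at_ : bool -> forall f : F, {ffun 'I_(ar f) -> Q} -> Q -> Prop.
Hypothesis preE : forall u q, run (vt true) (@at_ true) u q <->
  exists2 u', msteps u u' & run vt0 at0 u' q.
Hypothesis postE : forall v q, run (vt false) (@at_ false) v q <->
  (exists2 v', msteps v' v & run vt0 at0 v' q) /\ occ None v = 0.

Lemma traced_linked s t : traced s t -> linked vt at_ W s t.
Proof.
elim=> {s t} [f a b _ IH|l r u v sg tau s t Rlr s1 s2 nt_var lv ouv hi _ IH ->].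
  exact: linked_cong.
pose h o := if o is Some x then (if 0 < occ x v then Some x else None) else None.
have hv : rename h (rename Some v) = rename Some v.
  by rewrite rename_comp; apply: eq_in_subst => x hx; rewrite /h hx.
have [q1 [q2 [w r1 r2]]] : rule_base vt0 at0 W (rename h (rename Some l)) (rename h (rename Some r)).
  rewrite marked_ruleE; left; exists l, r, (fun x => h (Some x)).
  by rewrite !rename_comp.
have SI : injective (@Some X) by move=> ? ? [].
apply: (linked_rule (u := rename h u) (v := rename Some v) w _ _ _ _ _ _ IH).
- by apply/preE; exists (rename h (rename Some l)) => //; exact: msteps_rename.
- apply/postE; split.
    by exists (rename h (rename Some r)) => //; rewrite -hv; exact: msteps_rename.
  by apply/eqP; rewrite -leqn0 leqNgt; apply/negP; rewrite /rename => /occ_subst[].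
- move=> x; rewrite occ_rename_inj //; have /andP[le1 le2] := ouv x.
  case: (posnP (occ x v)) => [x0|xv].
    rewrite x0; apply/eqP; rewrite -leqn0 leqNgt; apply/negP.
    rewrite /rename => /occ_subst[[z|] _] //=; rewrite /h; case: ifP => // zv /=.
    by case: eqP => // -[xz]; rewrite -xz x0 in zv.
  rewrite (occ_rename_at (w := Some x)).
    by apply/eqP; rewrite eqn_leq le1 andbT; exact: leq_trans le2 xv.
  move=> [z|] //=; rewrite /h; case: ifP => [//|zv].
  by apply/esym/negP => /eqP[xz]; rewrite -xz xv in zv.
- by move=> x; rewrite occ_rename_inj.
- by apply: matches_rename hi => -[z|] //= t' ->; rewrite /h; case: ifP.
- exact/matches_Some.
Qed.

Lemma linked_derivation s t : linked vt at_ W s t -> csteps instance_rule s t.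
Proof.
elim=> {s t} [f a b _ IH|q1 q2 u v s1 s2 t1 t2 w hu hv _ _ i1 i2 _ IH].
  exact: csteps_app.
have [u' su ru] := (preE _ _).1 hu; have [[v' sv rv] v0] := (postE _ _).1 hv.
have suv : msteps u v.
  apply: rt_trans su (rt_trans _ _ _ _ _ _ sv); apply/rt_step/cstep_root.
  by rewrite -marked_ruleE; exists q1, q2.
have [t' st' it'] := marked_sound suv i1.
exact: rt_trans st' (matches_csteps v0 IH it' i2).
Qed.

Lemma linkedE : linked vt at_ W = derivation R.
Proof.
apply/funext => s; apply/funext => t; apply/propext; split.
  by move=> /linked_derivation/derivationE.
by move=> /derivation_traced/traced_linked.
Qed.
End Automata.
End Derivation.

(** * An automaton for the marked rules *)

Section Marked.
Variables (F : finType) (ar : F -> nat) (X : finType) (k : nat).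
Local Notation T := (term ar).
Variable A : 'I_k * bool -> automaton ar X.

(** The first kind of state remembers the renaming [eta], so that both sides of a rule are renamed
    alike; there are finitely many of them. [inr true] is reached by every term and [inr false] by
    the junk constant only, which yields the forgetting rule. *)
Local Notation Q := ({ffun X -> option X} * {ib : 'I_k * bool & state (A ib)} + bool)%type.

Definition marked_vt (o : option X) (q : Q) : Prop :=
  match q with
  | inl (eta, existT ib q) => exists x, eta x = o /\ q \in var_trans (A ib) x
  | inr b => b \/ o = None
  end.

Definition marked_at f (qs : {ffun 'I_(ar f) -> Q}) (q : Q) : Prop :=
  match q with
  | inl (eta, existT ib q) => exists qs' : {ffun 'I_(ar f) -> state (A ib)},
      (forall i, qs i = inl (eta, existT _ ib (qs' i))) /\ q \in app_trans qs'
  | inr b => b /\ forall i, qs i = inr true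
  end.

Definition marked_W (q1 q2 : Q) : Prop :=
  (exists eta i p1 p2, [/\ q1 = inl (eta, existT _ (i, true) p1),
     q2 = inl (eta, existT _ (i, false) p2), p1 \in final (A (i, true)) &
     p2 \in final (A (i, false))]) \/
  (q1 = inr true /\ q2 = inr false).

Lemma marked_run_inl eta ib q t :
  run marked_vt marked_at t (inl (eta, existT _ ib q)) <->
  exists2 t0 : T X, t = rename eta t0 & q \in reach (A ib) t0.
Proof.
elim/term_rec_ffun: t q => [o|f a IH] q.
  rewrite run_varE /=; split.
    by move=> [x [<- h]]; exists (Var x).
  by move=> [[x|//] [->] h]; exists x.
rewrite run_appE; split.
  move=> [qs h [qs' [e hq]]].
  have : forall i, exists t0 : T X, a i = rename eta t0 /\ qs' i \in reach (A ib) t0.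
    by move=> i; have := h i; rewrite e => /IH[t0]; exists t0.
  move=> /choice[b hb]; exists (App f (finfun b)).
    by rewrite /rename /=; congr App; apply/ffunP => i; rewrite !ffunE (hb i).1.
  rewrite /= inE; apply/existsP; exists qs'; rewrite hq andbT; apply/forallP => i.
  by rewrite ffunE (hb i).2.
move=> [[//|f' b] e]; have ff : f' = f by case: e.
subst f'; move/App_inj: e => e; rewrite /= inE => /existsP[qs' /andP[/forallP h hq]].
exists [ffun i => inl (eta, existT _ ib (qs' i))] => [i|].
  by rewrite ffunE; apply/IH; exists (b i) => //; rewrite e ffunE.
by exists qs'; split=> // i; rewrite ffunE.
Qed.

Lemma marked_run_true t : run marked_vt marked_at t (inr true).
Proof.
elim/term_rec_ffun: t => [o|f a IH]; first by apply: run_var; left.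
by apply/run_appE; exists [ffun=> inr true] => [i|]; [rewrite ffunE|split=> // i; rewrite ffunE].
Qed.

Lemma marked_run_false t : run marked_vt marked_at t (inr false) <-> t = Var None.
Proof.
split=> [|->]; last by apply: run_var; right.
case: t => [o|f a]; first by move=> /run_varE[|->].
by move=> /run_appE[qs _ []].
Qed.

Lemma marked_rule_base (R : set (T X * T X)) :
  (forall l r, R (l, r) <-> exists i, accepts (A (i, true)) l /\ accepts (A (i, false)) r) ->
  rule_base marked_vt marked_at marked_W = marked_rule R.
Proof.
move=> RE; apply/funext => s; apply/funext => t; apply/propext; split.
  move=> [q1 [q2 [[[eta [i [p1 [p2 [-> -> f1 f2]]]]]|[-> ->]]]]].
    move=> /marked_run_inl[l -> hl] /marked_run_inl[r -> hr]; left.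
    exists l, r, eta; split=> //; apply/RE; exists i; split; apply/existsP.
      by exists p1; rewrite f1.
    by exists p2; rewrite f2.
  by move=> _ /marked_run_false->; right.
case=> [[l [r [eta [/RE[i [/existsP[p1 /andP[f1 h1]] /existsP[p2 /andP[f2 h2]]]] -> ->]]]]|->].
  exists (inl (finfun eta, existT _ (i, true) p1)), (inl (finfun eta, existT _ (i, false) p2)).
  have eE w : rename eta w = rename (finfun eta) w :> term ar (option X).
    by apply: subst_ext => x; rewrite ffunE.
  split; first by left; exists (finfun eta), i, p1, p2.
    by apply/marked_run_inl; exists l.
  by apply/marked_run_inl; exists r.
exists (inr true), (inr false); split; first by right.
  exact: marked_run_true.
exact/marked_run_false.
Qed.
End Marked.

Theorem theorem3 (F : finType) (ar : F -> nat) (X : finType)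
    (R : set (term ar X * term ar X))
    (R_trs : is_trs R)
    (R_rec : recognizable_trs R)
    (R_lin : linear_trs R)
    (R_suffix : suffix_trs R) :
  exists Y : finType, Rat (pair_lang Y (derivation R)).
Proof.
have [[a0 _]|no_ground] := EM (exists t : term ar void, True); last first.
  exists void; rewrite (_ : pair_lang _ _ = classical_sets.set0).
    by apply: Rat_finite => //; exact: finite_set0.
  by apply/seteqP; split=> // w [s _]; case: no_ground; exists s.
have [k [U [V [UV ER]]]] := R_rec.
have /choice[AU hAU] : forall i, exists A, U i = [set t | accepts A t]%classic by move=> i; case: (UV i).
have /choice[AV hAV] : forall i, exists A, V i = [set t | accepts A t]%classic by move=> i; case: (UV i).
pose A (ib : 'I_k * bool) := if ib.2 then AU ib.1 else AV ib.1.
have RE l r : R (l, r) <-> exists i, accepts (A (i, true)) l /\ accepts (A (i, false)) r.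
  rewrite ER; split.
    by move=> [i _ []] /=; rewrite hAU hAV => h1 h2; exists i.
  by move=> [i [h1 h2]]; exists i => //; split; rewrite /= ?hAU ?hAV.
have mE := marked_rule_base RE.
have [vt1 [at1 pre]] := pre_regular (@marked_vt _ _ _ _ A) (@marked_at _ _ _ _ A) (@marked_W _ _ _ _ A).
have [vt2 [at2 post]] := post_regular (@marked_vt _ _ _ _ A) (@marked_at _ _ _ _ A) (@marked_W _ _ _ _ A).
rewrite mE in pre post.
(* Right patterns must not read junk, as [matches_csteps] requires. *)
pose vt (b : bool) := if b then vt1 else (fun v q => v != None /\ vt2 v q).
pose at_ (b : bool) := if b then at1 else at2.
have postE v q : run (vt false) (at_ false) v q <->
  (exists2 v', csteps (marked_rule R) v' v & run (@marked_vt _ _ _ _ A) (@marked_at _ _ _ _ A) v' q) /\ occ None v = 0.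
  by rewrite run_restrict post.
have := Rat_linked vt at_ (@marked_W _ _ _ _ A) a0.
rewrite (linkedE R_trs R_lin R_suffix mE pre postE) => h.
by eexists; exact: h.
Qed.
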